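(* Let $\alpha=\alpha_3\approx 1.46557$ be the real root of $t^3-t^2-1$ and let $$\Xi:=\{u_1\psi(1-\alpha)+u_2\psi(1-\alpha^2): u_1,u_2\in\mathbb{Z}\}.$$ Then $$\dim_H(\partial\mathcal{F}_\alpha)=\frac{2\log(\mu)}{\log(\alpha)}\approx 1.02952,$$ where $\mu\approx 1.21746$ is the dominant root of $t^7-2t^2-1$, and the collection $\{x+\mathcal{F}_\alpha: x\in\Xi\}\cup\{x+(\psi(1)-\mathcal{F}_\alpha): x\in\Xi\}$ is a proper tiling of $\mathbb{K}_\alpha=\mathbb{C}$.
   Context: Let $\beta=\alpha/(\alpha-1)$. Fix a non-real Galois conjugate $\alpha'$ of $\alpha$ and let $\psi:\mathbb{Q}(\alpha)\to\mathbb{C}$ be the field embedding with $\psi(\alpha)=\alpha'$. Both $\alpha$ and $\beta$ are Pisot units, so $f_L(x)=\psi(\alpha)x$ and $f_R(x)=\psi(\beta)(\psi(1)-x)$ are contractions of $\mathbb{C}$. The tent-tile $\mathcal{F}_\alpha$ is the unique non-empty compact set $\mathcal{F}_\alpha\subset\mathbb{C}$ with $\mathcal{F}_\alpha=f_L(\mathcal{F}_\alpha)\cup f_R(\mathcal{F}_\alpha)$. For a set $F$, $c-F=\{c-y:y\in F\}$. $\dim_H$ denotes Hausdorff dimension and $\partial$ the topological boundary. The dominant root of a polynomial is its root of largest modulus. A collection $\{Y_i:i\in I\}$ of compact subsets of a Euclidean space $\mathbb{E}$ is a (proper) tiling of $\mathbb{E}$ if (1) $\bigcup_{i\in I}Y_i=\mathbb{E}$;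 (2) for each compact $Y\subset\mathbb{E}$ the set $\{i\in I:Y\cap Y_i\neq\emptyset\}$ is finite; (3) for Lebesgue-almost every $x\in\mathbb{E}$ the set $\{i\in I:x\in Y_i\}$ has exactly one element. *)

(* Defs.v *)
From HB Require Import structures.
From mathcomp Require Import all_boot all_order all_algebra all_field.
From mathcomp Require Import all_classical all_reals all_analysis.
From mathcomp Require Import complex.

Set Implicit Arguments.
Unset Strict Implicit.
Unset Printing Implicit Defensive.

Import Order.TTheory GRing.Theory Num.Theory.
Import numFieldNormedType.Exports.

Local Open Scope classical_set_scope.
Local Open Scope ring_scope.

(* R[i]^o is R[i] seen as a one-dimensional normed space over itself; this is
   the structure carrying the usual topology of the complex plane. *)
Notation plane R := (R[i]%C^o).

Definition galois_conjugate (R : realType) (x : R) (y : R[i]%C) : Prop :=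
  exists p : {poly rat}, [/\ irreducible_poly p,
    root (map_poly ratr p) x & root (map_poly ratr p) y].

Definition dominant_root (L : numDomainType) (p : {poly L}) (z : L) : Prop :=
  root p z /\ forall w, root p w -> `|w| <= `|z|.

Definition boundary (T : topologicalType) (A : set T) : set T :=
  closure A `\` interior A.

Section Hausdorff.
Context {R : realType}.
Local Open Scope ereal_scope.

(* The norm of R[i] takes values in R[i], hence the real part. The value 0 is
   adjoined so that the empty set has diameter 0 rather than -oo. *)
Definition diam (A : set (plane R)) : \bar R :=
  ereal_sup (0 |` [set (complex.Re `|x - y|%R)%:E | x in A & y in A]).

Definition hausdorff_premeasure (s delta : R) (E : set (plane R)) : \bar R :=
  ereal_inf [set \sum_(k <oo) diam (U k) `^ s | U in
    [set U : nat -> set (plane R) |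
      E `<=` \bigcup_k U k /\ forall k, diam (U k) <= delta%:E]].

Definition hausdorff_measure (s : R) (E : set (plane R)) : \bar R :=
  ereal_sup [set hausdorff_premeasure s delta E | delta in
    [set delta : R | (0 < delta)%R]].

(* The exponent s = 0 is left out because of the convention for 0^0; this does
   not affect the infimum. *)
Definition hausdorff_dim (E : set (plane R)) : \bar R :=
  ereal_inf [set s%:E | s in [set s : R | (0 < s)%R /\
    hausdorff_measure s E = 0]].

End Hausdorff.

(* Lebesgue measure on the plane is the product measure on R * R. Tiles are
   counted by index: equal tiles with distinct indices count as different. *)
Definition proper_tiling (R : realType) (I : Type) (D : set I)
    (Y : I -> set (plane R)) : Prop :=
  [/\ forall i, D i -> compact (Y i),
      \bigcup_(i in D) Y i = setT,
      forall K : set (plane R), compact K ->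
        finite_set [set i | D i /\ K `&` Y i !=set0] &
      {ae ((@lebesgue_measure R) \x (@lebesgue_measure R))%E,
        forall p, exists! i, D i /\ Y i (p.1 +i* p.2)%C}].

Section TentTile.
Context {R : realType} {K : fieldExtType rat}.
Variables (psi : {rmorphism K -> R[i]%C}) (a : K).

Let b : K := a / (a - 1).

Definition tent_left (x : plane R) : plane R := psi a * x.
Definition tent_right (x : plane R) : plane R := psi b * (psi 1 - x).

Definition is_tent_tile (F : set (plane R)) : Prop :=
  [/\ F !=set0, compact F & F = tent_left @` F `|` tent_right @` F].

Definition tent_lattice : set (plane R) :=
  [set z | exists u1 u2 : int,
    z = u1%:~R * psi (1 - a) + u2%:~R * psi (1 - a ^+ 2)].

(* Indices in plane R * bool: (x, false) gives x + F and (x, true) gives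
   x + (psi 1 - F). *)
Definition tent_translate (F : set (plane R)) (i : plane R * bool) :
    set (plane R) :=
  [set i.1 + y | y in if i.2 then [set psi 1 - y' | y' in F] else F].

End TentTile.

(* Main.v *)
Require Import Defs.
From HB Require Import structures.
From Stdlib Require Import ZArith.
From mathcomp Require Import all_boot all_order all_algebra all_field.
From mathcomp Require Import all_classical all_reals all_analysis.
From mathcomp Require Import complex.
From mathcomp Require Import ring lra zify ssrZ.
Import Order.TTheory GRing.Theory Num.Theory.
Import numFieldNormedType.Exports.
Local Open Scope classical_set_scope.
Local Open Scope ring_scope.
Set Implicit Arguments.
Unset Strict Implicit.
Unset Printing Implicit Defensive.

Import Normc.

(* Write g for the conjugate alpha', so that g^3 = g^2 + 1 and |g|^2 = 1/alpha;
   then psi(beta) = g^3, and F is the union of L(F) and R(F) with L(x) = g x and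
   R(x) = g^3 (1 - x).

   Covering. The sets g^n (z + (-1)^e g^j F), z in Z[g], lie in the union of the
   tiles as soon as an integer height of z is in a suitable range, which makes
   that union dense; tiles are closed and locally finite.

   Overlaps and upper bound. Splitting F along L and R turns an intersection
   F ∩ (d + (-1)^e g^j F), d in Z[g], into two intersections of the same kind, and
   it is empty once |d| > 2.6. A finite computation reduces the intersection of
   F with any other tile to copies of E = F ∩ (1 - F) and two smaller pieces, and
   covers E by two copies of E scaled by g^5, one scaled by g^7, and smaller
   pieces. Hence an overlap needs only O(mu^n) discs of radius |g|^n. As
   mu < alpha, overlaps are null; as the boundary of F lies in finitely many
   overlaps, its dimension is at most 2 log mu / log alpha.

   Lower bound. F has interior and overlaps do not, so E lies in the boundary of
   F. The maps LRL, RLL and RRL send E to E, with ratios |g|^5, |g|^5, |g|^7,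
   and mu^-5 + mu^-5 + mu^-7 = 1 gives a mass distribution on E. A disc of
   radius |g|^n meets boundedly many cylinders of that size: their translation
   parts are in Z[g], bounded in both embeddings after division by g^n, and the
   word is determined by the map since the inverse branches on the real line are
   disjoint. *)

(** * The cubic field *)

(** The height at level 0 is [a + b + c]: its kernel in Z[g] is the lattice Xi and its value on 1 +
    Xi is 1. The conditions on the height are therefore exact integer windows that single out the
    tiles, and no estimate in the real embedding enters the covering argument. The bound |d| <= 2.6
    alone leaves infinitely many d in Z[g], so finiteness of the graph of intersections is not known
    beforehand; it is certified by the termination of the computed reduction. The count N(n) = 2
    N(n-5) + N(n-7) + const has growth rate mu, since mu^7 = 2 mu^2 + 1. The upper bound uses
    inclusions only. The lower bound needs separation of cylinders, which is not visible in the
    plane, where they may touch. On the real line the same words expand by powers of alpha, and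
    there their inverse branches are disjoint. No limit measure is constructed: masses are carried
    by words of a finite length, with bounds uniform in that length, and compactness of E reduces a
    cover to finitely many sets, which one sufficiently long length handles at once. *)

Definition tent_pair (R : realType) (al : R) (g : R[i]%C) :=
  [/\ al ^+ 3 = al ^+ 2 + 1, g ^+ 3 = g ^+ 2 + 1 & complex.Im g != 0].

Lemma cubic_root_bounds (R : realType) (t : R) : t ^+ 3 = t ^+ 2 + 1 ->
  146 / 100 < t < 147 / 100.
Proof.
move=> t3; have tt : t ^+ 2 * (t - 1) = 1.
  by rewrite mulrBr mulr1 -exprSr t3 addrAC subrr add0r.
apply/andP; split; rewrite ltNge; apply/negP => h; last by nra.
by have [h0|h0] := ltP t 1; [have := sqr_ge0 t; nra | nra].
Qed.

Lemma cubic_root_unique (R : realType) (t u : R) :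
  t ^+ 3 = t ^+ 2 + 1 -> u ^+ 3 = u ^+ 2 + 1 -> t = u.
Proof.
move=> t3 u3; have tb := cubic_root_bounds t3; have ub := cubic_root_bounds u3.
apply/eqP; rewrite -subr_eq0; apply/eqP.
have /eqP : (t - u) * (t ^+ 2 + t * u + u ^+ 2 - t - u) = 0.
  by transitivity ((t ^+ 3 - t ^+ 2) - (u ^+ 3 - u ^+ 2));
    [ring | rewrite t3 u3; ring].
by rewrite mulf_eq0 => /orP[/eqP //|/eqP]; nra.
Qed.

Section Conjugates.
Context {R : realType} {al : R} {g : R[i]%C}.
Hypothesis tp : tent_pair al g.

Lemma alpha_bounds : 146 / 100 < al < 147 / 100.
Proof. by case: tp => /cubic_root_bounds. Qed.

Lemma alpha_gt1 : 1 < al.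
Proof. have := alpha_bounds; lra. Qed.

Lemma alpha_gt0 : 0 < al.
Proof. have := alpha_bounds; lra. Qed.

Lemma alphaV : al^-1 = al ^+ 2 - al.
Proof.
have a0 : al != 0 by rewrite gt_eqF ?alpha_gt0.
case: tp => a3 _ _; apply: (mulfI a0).
by rewrite mulfV // mulrBr -exprS a3 -expr2; ring.
Qed.

(** The imaginary part of the cubic equation, divided by [Im g], gives the second identity.
    Substituted into the real part, it makes [1 - 2 Re g] a real root of the cubic, hence equal to
    [al]: the three roots have sum 1. *)
Lemma Re_conj_sub :
  complex.Re g = (1 - al) / 2 /\
  complex.Im g ^+ 2 = 3 * complex.Re g ^+ 2 - 2 * complex.Re g.
Proof.
have [a3 g3 y0] := tp.
case: g g3 y0 => x y /= /eqP; rewrite !exprS expr0 mulr1 eq_complex /=.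
move=> /andP[/eqP e1 /eqP e2] y0.
have ey : y ^+ 2 = 3 * x ^+ 2 - 2 * x.
  by apply: (mulfI y0); move: e2; rewrite !expr2; lra.
rewrite !expr0 !mulr1 -!expr2; split=> //; suff : 1 - 2 * x = al by lra.
by apply: cubic_root_unique a3; move: e1 ey; rewrite !expr2 => e1 ey; nra.
Qed.

Lemma Re_conj : complex.Re g = (1 - al) / 2.
Proof. by have [] := Re_conj_sub. Qed.

Lemma Im_conj_sqr : complex.Im g ^+ 2 = al ^+ 2 - al - (1 - al) ^+ 2 / 4.
Proof. by have [-> ->] := Re_conj_sub; field. Qed.

Lemma conj_neq0 : g != 0.
Proof. by have [_ _] := tp; apply: contra => /eqP ->. Qed.

(** The real quadratic factor of the cubic: [g] and its complex conjugate have sum [1 - al] and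
    product [1 / al = al^2 - al]. *)
Lemma conj_sqr : g ^+ 2 = (1 - al)%:C%C * g - (al ^+ 2 - al)%:C%C.
Proof.
have := Re_conj; have := Im_conj_sqr; case: g => x y /= ey ex.
apply/eqP; rewrite expr2 eq_complex /=; apply/andP; split; apply/eqP.
  by move: ey; rewrite expr2 => ey; rewrite ey ex; field.
by rewrite ex; field.
Qed.

Lemma normc_ge0 (z : R[i]%C) : 0 <= normc z.
Proof. by case: z => x y; rewrite sqrtr_ge0. Qed.

Lemma normc_sqr (z : R[i]%C) :
  normc z ^+ 2 = complex.Re z ^+ 2 + complex.Im z ^+ 2.
Proof. by case: z => x y /=; rewrite sqr_sqrtr ?addr_ge0 ?sqr_ge0. Qed.

Lemma conj_normc_sqr : normc g ^+ 2 = al ^+ 2 - al.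
Proof. by rewrite normc_sqr Im_conj_sqr Re_conj; field. Qed.

Lemma conj_normc_gt0 : 0 < normc g.
Proof.
rewrite lt_neqAle normc_ge0 andbT eq_sym.
by apply: contra conj_neq0 => /eqP /eq0_normc ->.
Qed.

Lemma conj_normc_bounds : 4 / 5 < normc g < 5 / 6.
Proof.
have := conj_normc_sqr; have := alpha_bounds; have := normc_ge0 g.
by move=> n0 ab n2; apply/andP; split; nra.
Qed.

Lemma normcX (z : R[i]%C) n : normc (z ^+ n) = normc z ^+ n.
Proof. by elim: n => [|n IHn]; rewrite ?normc1// !exprS normcM IHn. Qed.

End Conjugates.

(** * Overlaps of tiles *)

(* [(a, b, c)] encodes a + b g + c g^2, and [(j, e, d)] encodes the intersection of
   F with d + (-1)^e g^j F. *)
Definition ztriple := (Z * Z * Z)%type.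
Definition zstate := (nat * bool * ztriple)%type.

Local Open Scope Z_scope.

Definition zopp (z : ztriple) : ztriple :=
  let: (a, b, c) := z in (- a, - b, - c).
Definition zsub (z w : ztriple) : ztriple :=
  let: (a, b, c) := z in let: (a', b', c') := w in (a - a', b - b', c - c').
Definition zsign (e : bool) (z : ztriple) := if e then zopp z else z.
Definition zmulg (z : ztriple) : ztriple :=
  let: (a, b, c) := z in (c, a, b + c).
(* 1/g = g^2 - g *)
Definition zdivg (z : ztriple) : ztriple :=
  let: (a, b, c) := z in (b, c - a, a).
Definition zone : ztriple := (1, 0, 0).

(* The (p, q, r) with |z|^2 = p + q alpha + r alpha^2. *)
Definition zquad (z : ztriple) : ztriple :=
  let: (a, b, c) := z in
  (a * (a + b + c) - c * (b + c), c * c - b * (a + b + c),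
   b * (b + c) - a * c).

(* Sufficient for |z| > 2.6, from 1.46 < alpha < 1.47 and 2.13 < alpha^2 < 2.17. *)
Definition zfar (z : ztriple) : bool :=
  let: (p, q, r) := zquad z in
  676 <? 100 * p + (if 0 <=? q then 146 else 147) * q
                     + (if 0 <=? r then 213 else 217) * r.

Local Close Scope Z_scope.

(* The parts of an intersection inside L(F) and inside R(F) are similar copies of
   these intersections; the second component is the exponent of g in the ratio.
   For [j = 0] the left child exchanges the two sets, so that j <= 3 throughout. *)
Definition zchildL (s : zstate) : zstate * nat :=
  let: (j, e, d) := s in
  if j is j'.+1 then ((j', e, zdivg d), 1%N) else ((1%N, e, zsign (~~ e) d), 0%N).
Definition zchildR (s : zstate) : zstate * nat :=
  let: (j, e, d) := s in
  ((3 - j, ~~ e,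
    zsign e (zsub (iter (3 - j) zmulg zone) (iter j zdivg d)))%N, j).

(* F ∩ (1 - F), F ∩ (g - 1 + F) and F ∩ (1 - g + F). *)
Definition zleafA : zstate := (0%N, true, zone).
Definition zleafP (e : bool) : zstate :=
  (0%N, false, zsign e (Zneg 1, Zpos 1, Z0)).
Definition zleaves := [:: zleafA; zleafP false; zleafP true].

Definition zmerge (r1 r2 : option (seq (zstate * nat))) (k1 k2 : nat) :=
  if (r1, r2) is (Some l1, Some l2) then
    Some ([seq (p.1, k1 + p.2)%N | p <- l1] ++ [seq (p.1, k2 + p.2)%N | p <- l2])
  else None.

(** Splits once unconditionally, because [zreduce] applied to a leaf returns that leaf. *)
Definition zexpand (red : zstate -> option (seq (zstate * nat))) (s : zstate) :=
  zmerge (red (zchildL s).1) (red (zchildR s).1) (zchildL s).2 (zchildR s).2.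

(** [None] signals exhausted depth, so a [Some] result certifies a complete reduction; the empty
    list stands for an empty intersection. *)
Fixpoint zreduce (n : nat) (s : zstate) : option (seq (zstate * nat)) :=
  if s \in zleaves then Some [:: (s, 0%N)]
  else if zfar s.2 then Some [::]
  else if n is n'.+1 then zexpand (zreduce n') s else None.

(** Coordinates are kept in [Z] so that the reductions can be evaluated by [vm_compute]. *)
Definition zr {R : realType} (a : Z) : R := (int_of_Z a)%:~R.

Definition zeval (R : realType) (g : R[i]%C) (z : ztriple) : R[i]%C :=
  let: (a, b, c) := z in
  ((zr a)%:C + (zr b)%:C * g + (zr c)%:C * g ^+ 2)%C.

(** F lies in the disc of radius 13/10 about 0, so one disc of this radius holds any image of F
    under a similarity of ratio [|g|^n]. *)
Definition disc_covered (R : realType) (g : R[i]%C) (A : R[i]%C -> Prop) (n N : nat) :=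
  exists2 c : seq R[i]%C, (size c <= N)%N &
    forall x, A x -> exists2 p, p \in c & normc (x - p) <= 13 / 10 * normc g ^+ n.

Definition tent_set (R : realType) (g : R[i]%C) (F : R[i]%C -> Prop) :=
  forall x, F x <->
    (exists2 y, F y & x = g * y) \/ (exists2 y, F y & x = g ^+ 3 * (1 - y)).

Definition tile_overlap (R : realType) (g : R[i]%C) (F : R[i]%C -> Prop)
    (s : zstate) (x : R[i]%C) : Prop :=
  F x /\ exists2 y, F y & x = zeval g s.2 + (-1) ^+ s.1.2 * g ^+ s.1.1 * y.

Section Evaluation.
Context {R : realType} {g : R[i]%C}.
Hypothesis g3 : g ^+ 3 = g ^+ 2 + 1.

Local Notation zr := (@zr R).
Local Notation zval := (zeval g).

Lemma zrD a b : zr (Z.add a b) = zr a + zr b.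
Proof. by rewrite /zr -intrD -[in RHS]raddfD. Qed.
Lemma zrN a : zr (Z.opp a) = - zr a.
Proof. by rewrite /zr -mulrNz -[in RHS]raddfN. Qed.
Lemma zrB a b : zr (Z.sub a b) = zr a - zr b.
Proof. by rewrite -zrN -zrD. Qed.
Lemma zrM a b : zr (Z.mul a b) = zr a * zr b.
Proof. by rewrite /zr -intrM -[in RHS]rmorphM. Qed.

Lemma zval_opp z : zval (zopp z) = - zval z.
Proof. by case: z => -[a b] c; rewrite /zeval /= !zrN; ring. Qed.

Lemma zval_sub z w : zval (zsub z w) = zval z - zval w.
Proof.
by case: z w => -[a b] c [[a' b'] c']; rewrite /zeval /= !zrB; ring.
Qed.

Lemma zval_sign e z : zval (zsign e z) = (-1) ^+ e * zval z.
Proof. by case: e; rewrite /= ?zval_opp; ring. Qed.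

Lemma zval_one : zval zone = 1.
Proof.
by rewrite /zeval /= (_ : zr (Zpos 1) = 1)// (_ : zr Z0 = 0)// !rmorph0 !mul0r !addr0.
Qed.

Lemma zval_mulg z : zval (zmulg z) = g * zval z.
Proof.
case: z => -[a b] c; rewrite /zeval /= zrD.
rewrite !mulrDr [g * (_ * g ^+ 2)]mulrCA -exprS g3.
by ring.
Qed.

Lemma zmulgK z : zmulg (zdivg z) = z.
Proof. by case: z => -[a b] c /=; congr (_, _, _); lia. Qed.

Lemma zval_divg z : g * zval (zdivg z) = zval z.
Proof. by rewrite -zval_mulg zmulgK. Qed.

Lemma zval_iter_mulg n z : zval (iter n zmulg z) = g ^+ n * zval z.
Proof. by elim: n => [|n IHn]; rewrite ?mul1r // exprS /= zval_mulg IHn mulrA. Qed.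

Lemma zval_iter_divg n z : g ^+ n * zval (iter n zdivg z) = zval z.
Proof. by elim: n => [|n IHn]; rewrite ?mul1r // exprSr -mulrA zval_divg. Qed.

End Evaluation.

(** * Covering numbers of intersections of tiles *)

Section PairGraph.
Context {R : realType} {al : R} {g : R[i]%C}.
Hypothesis tp : tent_pair al g.

Local Notation zr := (@zr R).
Local Notation zval := (zeval g).
Local Notation covered := (disc_covered g).

Let g3 : g ^+ 3 = g ^+ 2 + 1. Proof. by have [] := tp. Qed.

Lemma normc_zval_sqr z : normc (zval z) ^+ 2 =
  let: (p, q, r) := zquad z in zr p + zr q * al + zr r * al ^+ 2.
Proof.
have := Re_conj tp; have := Im_conj_sqr tp; have [a3 _ _] := tp.
case: z => -[a b] c; rewrite /zquad /zeval /= !(zrD, zrB, zrM) normc_sqr.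
move: (zr a) (zr b) (zr c) => {}a {}b {}c; case: g => x y /= ey ex.
rewrite /= ?(mul0r, addr0, subr0, add0r).
transitivity ((a + b * x + c * (x ^+ 2 - y ^+ 2)) ^+ 2
              + y ^+ 2 * (b + 2 * c * x) ^+ 2); first by ring.
rewrite ey ex; apply/eqP; rewrite -subr_eq0; apply/eqP.
(* The two sides differ by a multiple of the cubic evaluated at [al]. *)
transitivity ((al ^+ 3 - (al ^+ 2 + 1)) * (c ^+ 2 * (al - 1) - b * c)).
  by field.
by rewrite a3 subrr mul0r.
Qed.

Lemma zr_le (a b : Z) : (Z.leb a b) -> zr a <= zr b.
Proof. by move=> h; rewrite /zr ler_int; lia. Qed.

Lemma zr_lt (a b : Z) : (Z.ltb a b) -> zr a < zr b.
Proof. by move=> h; rewrite /zr ltr_int; lia. Qed.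

Lemma zrE :
  ((zr Z0 = 0)%R * (zr (Zpos xH) = 1)%R *
   (forall p, (zr (Zpos (xO p)) = 2 * zr (Zpos p))%R) *
   (forall p, (zr (Zpos (xI p)) = 1 + 2 * zr (Zpos p))%R) *
   (forall p, (zr (Zneg p) = - zr (Zpos p))%R))%type.
Proof.
have zr1 : zr (Zpos xH) = 1 by [].
have zr2 : zr (Zpos 2) = 2 by [].
split; [split; [split; [by split|]|]|] => p; last by rewrite -zrN.
  by rewrite -zr2 -zrM.
by rewrite -zr2 -zrM -zr1 -zrD.
Qed.

Lemma zfarP z : zfar z -> 676 / 100 < normc (zval z) ^+ 2.
Proof.
rewrite normc_zval_sqr /zfar; case: (zquad z) => -[p q] r /zr_lt.
have /andP[a1 a2] := alpha_bounds tp.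
rewrite !(zrD, zrM).
have aux (t lo hi : R) (n : Z) (l h : positive) : lo <= t -> t <= hi ->
    zr (Zpos l) = 100 * lo -> zr (Zpos h) = 100 * hi ->
    zr (if Z.leb Z0 n then Zpos l else Zpos h) * zr n <= 100 * (zr n * t).
  move=> lt th el eh; case: ifP => [/zr_le|n0].
    by rewrite zrE => n0; rewrite el -mulrA [_ * zr n]mulrC ler_wpM2l // ler_wpM2l.
  have : zr n <= zr Z0 by apply: zr_le; clear -n0; lia.
  by rewrite zrE => {}n0; rewrite eh -mulrA [_ * zr n]mulrC ler_wpM2l // ler_wnM2l.
have s1 : 213 / 100 <= al ^+ 2 by nra.
have s2 : al ^+ 2 <= 217 / 100 by nra.
have zn n : zr (Zpos n) = (nat_of_pos n)%:R.
  by rewrite /zr /= (_ : Pos.to_nat n = nat_of_pos n) //; lia.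
have hq : zr (if Z.leb Z0 q then Zpos 146 else Zpos 147) * zr q <= 100 * (zr q * al).
  by apply: (aux _ _ _ _ _ _ (ltW a1) (ltW a2)); rewrite zn /=; field.
have hr : zr (if Z.leb Z0 r then Zpos 213 else Zpos 217) * zr r
          <= 100 * (zr r * al ^+ 2).
  by apply: (aux _ _ _ _ _ _ s1 s2); rewrite zn /=; field.
by move: hq hr; set u := zr (if _ then _ else _); set v := zr (if _ then _ else _);
  rewrite !zn /=; lra.
Qed.

Lemma conj_normcX_le m n : (m <= n)%N -> normc g ^+ n <= normc g ^+ m.
Proof.
move=> mn; have /andP[_ n1] := conj_normc_bounds tp.
by apply: ler_wiXn2l => //; rewrite ?normc_ge0 //; lra.
Qed.

Lemma covered_sub (A B : R[i]%C -> Prop) m n M N : (forall x, A x -> B x) ->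
  (m <= n)%N -> (N <= M)%N -> covered B n N -> covered A m M.
Proof.
move=> AB mn NM [c cN cB]; exists c; first exact: leq_trans NM.
move=> x /AB /cB[p pc xp]; exists p => //; apply: le_trans xp _.
by rewrite ler_wpM2l ?conj_normcX_le //; lra.
Qed.

Lemma covered_empty (A : R[i]%C -> Prop) n : (forall x, ~ A x) -> covered A n 0.
Proof. by move=> A0; exists [::] => // x /A0. Qed.

Lemma covered_or (A B : R[i]%C -> Prop) n M N :
  covered A n M -> covered B n N -> covered (fun x => A x \/ B x) n (M + N).
Proof.
move=> [c cM cA] [d dN dB]; exists (c ++ d); first by rewrite size_cat leq_add.
by move=> x [/cA|/dB] [p pc xp]; exists p => //; rewrite mem_cat pc ?orbT.
Qed.

Lemma covered_affine (A B : R[i]%C -> Prop) (u v : R[i]%C) k n N :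
  normc u = normc g ^+ k -> (forall x, A x -> exists2 y, B y & x = u * y + v) ->
  covered B (n - k) N -> covered A n N.
Proof.
move=> uk AB [c cN cB]; exists [seq u * p + v | p <- c]; rewrite ?size_map //.
move=> x /AB[y /cB[p pc yp] ->]; exists (u * p + v); first by apply/mapP; exists p.
rewrite (_ : _ - _ = u * (y - p)); last by ring.
rewrite normcM uk.
(* The subtraction is truncated; [k + (n - k) >= n] holds in every case and is all that the radius
   requires. *)
apply: (@le_trans _ _ (13 / 10 * normc g ^+ (k + (n - k)))).
  by rewrite exprD mulrCA ler_wpM2l // exprn_ge0 ?normc_ge0.
by rewrite ler_wpM2l ?conj_normcX_le //; lia.
Qed.

Context {F : R[i]%C -> Prop}.
Hypothesis FE : tent_set g F.
Hypothesis Fb : forall x, F x -> normc x <= 13 / 10.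

Local Notation overlap := (tile_overlap g F).

(** A crude count that settles the small [n] from which the recursions below start. *)
Lemma covered_tile n : covered F n (2 ^ n).
Proof.
elim: n => [|n IHn].
  by exists [:: 0] => // x /Fb x2; exists 0; rewrite ?mem_head // subr0 expr0 mulr1.
rewrite expnS mul2n -addnn.
have := @covered_or (fun x => exists2 y, F y & x = g * y)
  (fun x => exists2 y, F y & x = g ^+ 3 * (1 - y)) n.+1 (2 ^ n) (2 ^ n).
set G := (fun x => _ \/ _) => h; apply: (@covered_sub _ G n.+1 n.+1 _ (2 ^ n + 2 ^ n)) => //.
  by move=> x /FE.
apply: {G} h.
  apply: (@covered_affine _ F g 0 1); rewrite ?subn1 ?expr1 //.
  by move=> x [y Fy ->]; exists y; rewrite ?addr0.
apply: (@covered_affine _ F (- g ^+ 3) (g ^+ 3) 3).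
- by rewrite normcN normcX.
- by move=> x [y Fy ->]; exists y => //; ring.
- by apply: covered_sub IHn => //; lia.
Qed.

Lemma sign_normc (e : bool) : normc ((-1) ^+ e : R[i]%C) = 1.
Proof. by case: e; rewrite ?normcN normc1. Qed.

Lemma overlap_far s x : zfar s.2 -> ~ overlap s x.
Proof.
move=> /zfarP far [/Fb x2 [y /Fb y2 xy]].
have y3 : normc (g ^+ s.1.1 * y) <= 13 / 10.
  rewrite normcM normcX; apply: le_trans y2.
  by rewrite ler_piMl ?normc_ge0 //; exact: (@conj_normcX_le 0).
have := le_normcD x (- ((-1) ^+ s.1.2 * g ^+ s.1.1 * y)).
rewrite [X in normc (X - _)]xy addrK normcN -mulrA normcM sign_normc mul1r.
move: far (normc_ge0 (zval s.2)); nra.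
Qed.

(** For a positive exponent both sets are divided by g. For exponent 0 the second set cannot be
    divided, so [x = g f = d + (-1)^e y] is solved for [y], which lies in F and in a translate of a
    copy of [g F]. *)
Lemma overlap_childL s : exists u v, normc u = normc g ^+ (zchildL s).2 /\
  forall x, overlap s x -> (exists2 f, F f & x = g * f) ->
    exists2 y, overlap (zchildL s).1 y & x = u * y + v.
Proof.
case: s => -[[|j] e] d /=.
  exists ((-1) ^+ e), (zval d); rewrite sign_normc; split=> // x [Fx [y Fy /= xy]] [f Ff xf].
  exists y; last by rewrite xy; ring.
  split=> //=; exists f => //; rewrite zval_sign signrN -/g expr1 -mulrA -xf xy.
  rewrite -signr_odd; case: (e); rewrite /=; ring.
exists g, 0; rewrite expr1; split=> // x [Fx [y Fy /= xy]] [f Ff xf].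
exists f; last by rewrite addr0.
split=> //=; exists y => //; apply: (mulfI (conj_neq0 tp)).
by rewrite -xf xy mulrDr (zval_divg g3) exprS; ring.
Qed.

(** Solving [g^3 (1 - f) = d + (-1)^e g^j y] for [y] gives a point of F that also lies in a
    translate of [g^(3-j) F] or of its negative. The two sets exchange roles, and [x] is the image
    of [y] with ratio [g^j]. *)
Lemma overlap_childR s : (s.1.1 <= 3)%N ->
  exists u v, normc u = normc g ^+ (zchildR s).2 /\
  forall x, overlap s x -> (exists2 f, F f & x = g ^+ 3 * (1 - f)) ->
    exists2 y, overlap (zchildR s).1 y & x = u * y + v.
Proof.
case: s => -[j e] d /= j3; exists ((-1) ^+ e * g ^+ j), (zval d).
rewrite normcM sign_normc mul1r normcX; split=> // x [Fx [y Fy /= xy]] [f Ff xf].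
exists y; last by rewrite xy addrC.
split=> //=; exists f => //.
rewrite zval_sign zval_sub (zval_iter_mulg g3) zval_one mulr1.
have gj : g ^+ j != 0 by rewrite expf_neq0 ?(conj_neq0 tp).
apply: (mulfI gj); have e2 : (-1) ^+ e * (-1) ^+ e = 1 :> R[i]%C by rewrite -signr_addb addbb.
have g3E : g ^+ j * g ^+ (3 - j) = g ^+ 3 by rewrite -exprD subnKC.
have dE := zval_iter_divg g3 j d.
transitivity ((-1) ^+ e * (g ^+ j * g ^+ (3 - j)) * (1 - f)
              - (-1) ^+ e * (g ^+ j * zval (iter j zdivg d))).
  by rewrite g3E dE -mulrA -xf xy -mulrBr addrAC subrr add0r !mulrA e2 mul1r.
by case: (e) => /=; ring.
Qed.

(** The bound [N] is arbitrary, so the statement can be applied inside an induction on [n] with the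
    very bound under proof. *)
Definition reduction_sound (red : zstate -> option (seq (zstate * nat))) :=
  forall s l (N : zstate -> nat -> nat) n, (s.1.1 <= 3)%N -> red s = Some l ->
    {in l, forall p, covered (overlap p.1) (n - p.2) (N p.1 (n - p.2)%N)} ->
    covered (overlap s) n (\sum_(p <- l) N p.1 (n - p.2))%N.

Lemma zexpand_sound red : reduction_sound red -> reduction_sound (zexpand red).
Proof.
move=> red_sound s l N n j3; rewrite /zexpand /zmerge.
case r1 : (red _) => [l1|//]; case r2 : (red _) => [l2|//] [<-] cl.
have jL : ((zchildL s).1.1.1 <= 3)%N by case: s j3 {r1 r2 cl} => -[[|j] e] d //= /ltnW.
have jR : ((zchildR s).1.1.1 <= 3)%N by case: s j3 {r1 r2 cl jL} => -[j e] d _ /=; lia.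
have sub k (s' : seq (zstate * nat)) :
    (\sum_(p <- s') N p.1 (n - (k + p.2)) = \sum_(p <- s') N p.1 (n - k - p.2))%N.
  by apply: eq_bigr => p _; rewrite subnDA.
rewrite big_cat !big_map /= !sub.
have [uL [vL [nL hL]]] := overlap_childL s.
have [uR [vR [nR hR]]] := overlap_childR j3.
set BL := fun x => overlap s x /\ exists2 f, F f & x = g * f.
set BR := fun x => overlap s x /\ exists2 f, F f & x = g ^+ 3 * (1 - f).
apply: (@covered_sub _ (fun x => BL x \/ BR x) n n) (leqnn n) (leqnn _) _.
  by move=> x sx; have [/FE[] xf _] := sx; [left | right].
apply: covered_or.
  apply: (covered_affine nL (fun x (h : BL x) => hL x h.1 h.2)).
  apply: (red_sound _ _ N) r1 _ => // p pl; rewrite -subnDA.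
  by apply: (cl (p.1, (zchildL s).2 + p.2)%N); rewrite mem_cat; apply/orP; left; apply/mapP; exists p.
apply: (covered_affine nR (fun x (h : BR x) => hR x h.1 h.2)).
apply: (red_sound _ _ N) r2 _ => // p pl; rewrite -subnDA.
by apply: (cl (p.1, (zchildR s).2 + p.2)%N); rewrite mem_cat; apply/orP; right; apply/mapP; exists p.
Qed.

Lemma zreduce_sound k : reduction_sound (zreduce k).
Proof.
have base s l (N : zstate -> nat -> nat) n :
    (if s \in zleaves then Some [:: (s, 0%N)]
     else if zfar s.2 then Some [::] else None) = Some l ->
    {in l, forall p, covered (overlap p.1) (n - p.2) (N p.1 (n - p.2)%N)} ->
    covered (overlap s) n (\sum_(p <- l) N p.1 (n - p.2))%N.
  case: ifP => [_ [<-] /(_ _ (mem_head _ _))|_]; first by rewrite big_seq1 /= subn0.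
  case: ifP => // far [<-] _; rewrite big_nil; apply: covered_empty => x.
  exact: overlap_far.
elim: k => [|k IHk] s l N n j3 /=; first exact: base.
have := base s l N n; case: ifP => // _; case: ifP => // _ _.
exact: (zexpand_sound IHk).
Qed.

(** The leaf is contained in a single copy, scaled by [g^5], of a leaf of the same kind; it is thus
    at most a point, and its count stays constant. The value 32 = 2^5 serves the levels up to 5. *)
Lemma covered_leafP e n : covered (overlap (zleafP e)) n 32.
Proof.
elim/ltn_ind: n e => n IHn e.
have [n5|n5] := leqP n 5.
  apply: (@covered_sub _ F n n 32 (2 ^ n)) (covered_tile n) => //.
    by move=> x [].
  by rewrite (@leq_exp2l 2 n 5).
have red : zexpand (zreduce 20) (zleafP e) = Some [:: (zleafP true, 5%N)].
  by case: e; vm_compute.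
have := zexpand_sound (@zreduce_sound 20) (s := zleafP e) _ red.
move=> /(_ (fun=> fun=> 32%N) n isT); rewrite big_seq1; apply.
by move=> p; rewrite inE => /eqP -> /=; apply: IHn; lia.
Qed.

(* The recursion mirrors [zleafA_parts], where the eight leaves other than [zleafA]
   cost 32 discs each. *)
Fixpoint leaf_count (n : nat) : nat :=
  if n is (((n'.+1.+1) as m).+1.+1.+1.+1.+1)%N then
    (2 * leaf_count m + leaf_count n' + 256)%N else 128.

Lemma leaf_count7 n :
  leaf_count n.+4.+3 = (2 * leaf_count n.+2 + leaf_count n + 256)%N.
Proof. by []. Qed.

Definition leaf_bound (s : zstate) (m : nat) : nat :=
  if s == zleafA then leaf_count m else 32.

Definition zleafA_parts : seq (zstate * nat) :=
  [:: (zleafP false, 4%N); (zleafP true, 7%N); (zleafA, 5%N); (zleafP true, 10%N);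
      (zleafP false, 4%N); (zleafP true, 7%N); (zleafA, 5%N); (zleafP true, 10%N);
      (zleafP true, 6%N); (zleafP true, 6%N); (zleafA, 7%N)].

Lemma zleafA_expand : zexpand (zreduce 20) zleafA = Some zleafA_parts.
Proof. by vm_compute. Qed.

Lemma leaf_boundA m : leaf_bound zleafA m = leaf_count m.
Proof. by []. Qed.

Lemma leaf_boundP e m : leaf_bound (zleafP e) m = 32%N.
Proof. by case: e. Qed.

Lemma zleafA_parts_bound n :
  (\sum_(p <- zleafA_parts) leaf_bound p.1 (n.+4.+3 - p.2))%N = leaf_count n.+4.+3.
Proof.
rewrite !big_cons big_nil !leaf_boundA !leaf_boundP leaf_count7.
rewrite /= !subSS !subn0.
by move: (leaf_count n.+2) (leaf_count n) => a b; lia.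
Qed.

Lemma zleaf_cases s : s \in zleaves -> s = zleafA \/ exists e, s = zleafP e.
Proof.
rewrite !inE => /or3P[] /eqP ->; first by left.
  by right; exists false.
by right; exists true.
Qed.

Lemma covered_leafA n : covered (overlap zleafA) n (leaf_count n).
Proof.
elim/ltn_ind: n => n IHn.
have [n7|n7] := ltnP n 7.
  apply: (@covered_sub _ F n n _ (2 ^ n)) (covered_tile n) => //.
    by move=> x [].
  by move: n n7 {IHn}; do 7!case=> //.
have j0 : (zleafA.1.1 <= 3)%N by [].
apply: (covered_sub (fun x h => h) (leqnn n) _
  (zexpand_sound (@zreduce_sound 20) (N := leaf_bound) (n := n) j0 zleafA_expand _)).
  have [k ->] : exists k, n = k.+4.+3 by exists (n - 7)%N; move: n7; clear; lia.
  by rewrite zleafA_parts_bound.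
have parts_leaf : all (fun p => (p.1 \in zleaves) && (0 < p.2)%N) zleafA_parts by vm_compute.
move=> p /(allP parts_leaf) /andP[/zleaf_cases[-> p0|[e ->] _]].
  by rewrite leaf_boundA; apply: IHn; rewrite ltn_subrL p0 (leq_trans _ n7).
by rewrite leaf_boundP; exact: covered_leafP.
Qed.

Lemma leaf_count_mono m n : (m <= n)%N -> (leaf_count m <= leaf_count n)%N.
Proof.
move: m n; apply: (homo_leq leqnn leq_trans).
elim/ltn_ind=> n IHn; have [n7|n7] := ltnP n 7.
  by move: n n7 {IHn}; do 7!case=> //.
move: n n7 IHn; do 7!case=> //; move=> n _ IHn.
have h1 := IHn n.+2 ltac:(lia); have h2 := IHn n ltac:(lia).
rewrite !leaf_count7.
by move: (leaf_count n.+2) (leaf_count n.+3) h1 (leaf_count n) (leaf_count n.+1) h2;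
  clear; lia.
Qed.

Lemma leaf_count_ge n : (128 <= leaf_count n)%N.
Proof. exact: (leaf_count_mono (leq0n n)). Qed.

(** Assuming an inequality for [mu] lets the estimate serve both the exact root and the rational
    5/4. *)
Lemma leaf_count_le (mu : R) n : 1 <= mu -> 2 * mu ^+ 2 + 1 <= mu ^+ 7 ->
  (leaf_count n)%:R <= 256 * mu ^+ n.
Proof.
(* The sequence [leaf_count n + 128] satisfies the homogeneous recurrence v(n+7) = 2 v(n+2) + v(n),
   so this stronger bound passes through the induction. *)
move=> mu1 mu7; suff : (leaf_count n)%:R <= 256 * mu ^+ n - 128 by lra.
elim/ltn_ind: n => n IHn; have [n7|n7] := ltnP n 7.
  have -> : leaf_count n = 128%N by move: n n7 {IHn}; do 7!case=> //.
  have : 1 <= mu ^+ n by exact: exprn_ege1.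
  lra.
move: n n7 IHn; do 7!case=> //; move=> n _ IHn.
have h1 := IHn n.+2 ltac:(lia); have h2 := IHn n ltac:(lia).
have m0 : 0 <= mu ^+ n by rewrite exprn_ge0 //; lra.
apply: (@le_trans _ _ (256 * ((2 * mu ^+ 2 + 1) * mu ^+ n) - 128)).
  rewrite leaf_count7 natrD (natrD _ (2 * leaf_count n.+2)%N) natrM.
  move: h1 h2; rewrite -addn2 addnC exprD.
  by move: (leaf_count _)%:R (leaf_count n)%:R (mu ^+ n) (mu ^+ 2) => a b c d; lra.
by rewrite -[n.+4.+3]/(7 + n)%N exprD lerD2r ler_pM2l // ler_wpM2r.
Qed.

(** The translation is [e + u (1 - g) + v (1 - g^2)] in the basis 1, g, g^2: a point of Xi,
    increased by 1 for a reflected tile. *)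
Definition zneighbour (e : bool) (u v : Z) : zstate :=
  (0%N, e, (Z.add (if e then Zpos 1 else Z0) (Z.add u v), Z.opp u, Z.opp v)).

(** The range is -5 to 5: a translation of modulus at most 2.6 has [|u|] and [|v|] at most 5.7, see
    [shift_bounded]. *)
Definition zbox : seq Z := [seq Z.sub (Z.of_nat k) (Zpos 5) | k <- iota 0 11].

Lemma neighbours_reduce : all (fun e => all (fun u => all (fun v =>
    (~~ e && (u == Z0) && (v == Z0)) ||
    (if zreduce 20 (zneighbour e u v) is Some l then
      (size l <= 11)%N && all (fun p => p.1 \in zleaves) l else false))
  zbox) zbox) [:: false; true].
Proof. by vm_compute. Qed.

Lemma covered_neighbour_box e u v n : u \in zbox -> v \in zbox ->
  ~~ (~~ e && (u == Z0) && (v == Z0)) ->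
  covered (overlap (zneighbour e u v)) n (11 * leaf_count n).
Proof.
move=> ub vb nz.
have ee : e \in [:: false; true] by case: (e).
have := allP (allP (allP neighbours_reduce e ee) u ub) v vb; rewrite (negbTE nz) orFb.
case red : (zreduce _ _) => [l|//] /andP[l11 /allP ll].
have cl : {in l, forall p, covered (overlap p.1) (n - p.2) (leaf_count (n - p.2))}.
  move=> p /ll /zleaf_cases [->|[e' ->]]; first exact: covered_leafA.
  apply: (covered_sub _ (leqnn _) _ (covered_leafP e' (n - p.2))) => //.
  exact: leq_trans (leaf_count_ge _).
have j0 : ((zneighbour e u v).1.1 <= 3)%N by [].
apply: (covered_sub _ (leqnn _) _
  (@zreduce_sound 20 _ _ (fun=> leaf_count) n j0 red cl)) => //.
apply: (@leq_trans (\sum_(p <- l) leaf_count n)%N).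
  by apply: leq_sum => p _; apply: leaf_count_mono; exact: leq_subr.
by rewrite big_const_seq count_predT iter_addn_0 mulnC leq_mul2r l11 orbT.
Qed.
End PairGraph.

(** * The tiles cover the plane *)

(** Rounding [y] and [z] costs at most 1 each, amplified by [T / S <= 2] and [U / S <= 4]; this puts
    [x - a] between -6 and 1. *)
Lemma rounding_bound (R : realType) (S T U a b c x y z : R) :
  0 < S -> 0 <= T <= 2 * S -> 0 <= U <= 4 * S -> x * S + y * T + z * U = 0 ->
  a * S <= - (b * T + c * U) < (a + 1) * S -> b <= y < b + 1 -> c <= z < c + 1 ->
  `|x - a| <= 6.
Proof.
move=> S0 /andP[T0 T1] /andP[U0 U1] e0 /andP[a1 a2] /andP[b1 b2] /andP[c1 c2].
have b3 : 0 <= (y - b) * T by rewrite mulr_ge0 // subr_ge0.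
have b4 : (y - b) * T <= 1 * T by rewrite ler_wpM2r //; lra.
have c3 : 0 <= (z - c) * U by rewrite mulr_ge0 // subr_ge0.
have c4 : (z - c) * U <= 1 * U by rewrite ler_wpM2r //; lra.
by rewrite ler_norml; apply/andP; split; rewrite -(ler_pM2r S0); lra.
Qed.

(** A reflected tile [x + (1 - F)] is written as [(x + 1) - F], so both kinds of tiles have the form
    [shift + (-1)^e F]. *)
Definition shift (R : realType) (g : R[i]%C) (e : bool) (u v : int) : R[i]%C :=
  e%:R + u%:~R * (1 - g) + v%:~R * (1 - g ^+ 2).

Definition in_tile (R : realType) (g : R[i]%C) (F : R[i]%C -> Prop)
    (e : bool) (u v : int) (x : R[i]%C) : Prop :=
  exists2 y, F y & x = shift g e u v + (-1) ^+ e * y.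

Definition in_tiles (R : realType) (g : R[i]%C) (F : R[i]%C -> Prop)
    (x : R[i]%C) : Prop := exists e u v, in_tile g F e u v x.

Definition ival (R : realType) (g : R[i]%C) (a b c : int) : R[i]%C :=
  a%:~R + b%:~R * g + c%:~R * g ^+ 2.

(* Three consecutive terms of s_(n+3) = s_(n+2) + s_n. The height
   h_n(a + b g + c g^2) = a s_n + b s_(n+1) + c s_(n+2) satisfies
   h_(n+1)(z) = h_n(g z). *)
Fixpoint height_seq (n : nat) : int * int * int :=
  if n is n'.+1 then let: (s, t, u) := height_seq n' in (t, u, s + u)
  else (1, 1, 1).

Section Covering.
Context {R : realType} {al : R} {g : R[i]%C}.
Hypothesis tp : tent_pair al g.
Context {F : R[i]%C -> Prop}.
Hypothesis FE : tent_set g F.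
Hypothesis Fb : forall x, F x -> normc x <= 13 / 10.

Local Notation shift := (shift g).
Local Notation in_tile := (in_tile g F).
Local Notation in_tiles := (in_tiles g F).
Local Notation ival := (ival g).

Lemma height_seq_bounds n : let: (s, t, u) := height_seq n in
  [/\ 1 <= s, s <= t, t <= u, t <= 2 * s & u <= 2 * t].
Proof.
elim: n => //= n; case: (height_seq n) => -[s t] u [h1 h2 h3 h4 h5].
by split; lia.
Qed.

(** At level 0 the only nonempty window is [d = 0], which describes the tiles themselves. For the
    next level, [g^(n+1) (z + y)] is rewritten as [g^n (g z + g y)]: the height is unchanged and the
    pieces F, gF, g^2 F become gF, g^2 F, g^3 F. The first is also part of F, which is why its
    window [[0, t)] is the union of two old ones; the last has to be turned over. *)
Lemma in_tiles_level n (e : bool) (a b c : int) :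
  let: (s, t, u) := height_seq n in
  let h := a * s + b * t + c * u in
  let d := if e then h - 1 else - h in
  [/\ 0 <= d < s -> forall y, F y ->
        in_tiles (g ^+ n * (ival a b c + (-1) ^+ e * y)),
      s <= d < t -> forall y, F y ->
        in_tiles (g ^+ n * (ival a b c + (-1) ^+ e * (g * y))) &
      t <= d < u -> forall y, F y ->
        in_tiles (g ^+ n * (ival a b c + (-1) ^+ e * (g ^+ 2 * y)))].
Proof.
have [_ g3 _] := tp.
elim: n e a b c => [|n IHn] e a b c.
  rewrite /=; split; [|lia|lia].
  move=> d0 y Fy; exists e, (- b), (- c), y => //.
  have -> : a = e%:R - b - c by case: (e) d0 => /=; lia.
  rewrite expr0 mul1r /ival /shift !(rmorphB, rmorphN) /=.
  by case: (e); rewrite /= ?rmorph1 ?rmorph0; ring.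
rewrite /=; have := height_seq_bounds n.
case: (height_seq n) IHn => -[s t] u IHn [h1 h2 h3 h4 h5].
set h := a * t + b * u + c * (s + u).
have hE : c * s + a * t + (b + c) * u = h by rewrite /h; ring.
have gE y : g ^+ n.+1 * (ival a b c + y) = g ^+ n * (ival c a (b + c) + g * y).
  rewrite exprSr -mulrA; congr (_ * _); rewrite mulrDr; congr (_ + _).
  rewrite /ival rmorphD /= !mulrDr [g * (_ * g ^+ 2)]mulrCA -exprS g3.
  by ring.
have := IHn e c a (b + c); rewrite hE /=; set d := if e then _ else _.
move=> [H0 H1 H2]; split=> dd y Fy; rewrite gE.
- have [ds|ds] := ltP d s.
    rewrite mulrCA; apply: H0; first by move: dd ds; clear; lia.
    by apply/FE; left; exists y.
  by rewrite mulrCA; apply: H1 => //; move: dd ds; clear; lia.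
- by rewrite mulrCA [g * (g * y)]mulrA -expr2; apply: H2.
(* Since [g^3 y = g^3 - g^3 (1 - y)], the piece lies in a reflected tile whose centre is moved by
   [k g^3 = k (1 + g^2)]. This changes [d] to [s + u - 1 - d] and carries the window [[u, s + u)]
   onto [[0, s)]. *)
- pose k : int := if e then -1 else 1.
  have [{}H0 _ _] := IHn (~~ e) (c + k) a (b + c + k).
  have := H0 _ (g ^+ 3 * (1 - y)) _.
  have -> : ival (c + k) a (b + c + k) + (-1) ^+ (~~ e) * (g ^+ 3 * (1 - y)) =
       ival c a (b + c) + g * ((-1) ^+ e * (g ^+ 2 * y)).
    rewrite [g * _]mulrCA [g * (_ * _)]mulrA -exprS g3 /ival /k !rmorphD /=.
    by case: (e); rewrite /= ?rmorphN ?rmorph1; ring.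
  apply; last by apply/FE; right; exists y.
  have -> : (c + k) * s + a * t + (b + c + k) * u = h + k * (s + u).
    by rewrite -hE; ring.
  by move: dd; rewrite /d /k; case: (e) => /=; clear -h1 h2 h3; lia.
Qed.

(** The point [p / g^n] is a real combination of 1, g, g^2 of height 0. Rounding the coefficients to
    integers whose negated height lies in [[0, s)] costs a bounded error, which the factor [g^n]
    then shrinks. *)
Lemma in_tiles_dense (p : R[i]%C) n : (exists y, F y) ->
  exists2 q, in_tiles q & normc (p - q) <= 10 * normc g ^+ n.
Proof.
move=> [y0 Fy0]; have := height_seq_bounds n.
have lvl a b c := in_tiles_level n false a b c; move: lvl.
case: (height_seq n) => -[s t] u lvl [h1 h2 h3 h4 h5].
have gn : g ^+ n != 0 by rewrite expf_neq0 ?(conj_neq0 tp).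
pose p' := p / g ^+ n.
have [_ _ y0g] := tp; have Reg := Re_conj tp; have ab := alpha_bounds tp.
pose X := complex.Im p' / complex.Im g; pose Y := complex.Re p' - X * complex.Re g.
have pE : p' = Y%:C%C + X%:C%C * g.
  rewrite /Y /X; move: y0g; case: (p') => a b; case: (g) => c d /= d0.
  by apply/eqP; rewrite eq_complex /=; apply/andP; split; apply/eqP; field.
pose S : R := s%:~R; pose T : R := t%:~R; pose U : R := u%:~R.
have S1 : 1 <= S by rewrite /S -[1]/(1%:~R) ler_int.
have [T1 T2] : S <= T /\ T <= 2 * S.
  by rewrite /S /T -[2 * _]/(2%:~R * _) -intrM !ler_int.
have [U1 U2] : T <= U /\ U <= 2 * T.
  by rewrite /U /T -[2 * _]/(2%:~R * _) -intrM !ler_int.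
(* Adding [cr] times the vanishing quadratic [g^2 - (1 - al) g + (al^2 - al)] to [Y + X g] keeps the
   value and changes the height by [cr W]; [cr] is chosen to make the height 0. *)
pose W := S * (al ^+ 2 - al) + (al - 1) * T + U.
have W0 : 0 < W by rewrite /W; nra.
pose cr := - (Y * S + X * T) / W.
pose br := X - (1 - al) * cr; pose ar := Y + cr * (al ^+ 2 - al).
have h0 : ar * S + br * T + cr * U = 0.
  transitivity (Y * S + X * T + cr * W); first by rewrite /ar /br /W; ring.
  by rewrite /cr divfK ?gt_eqF // subrr.
pose c := Num.floor cr; pose b := Num.floor br.
(* Rounded last, from the integers [b] and [c] already chosen, so that the negated height falls in
   [[0, s)]. *)
pose a := Num.floor (- (b%:~R * T + c%:~R * U) / S).
have fl (x : R) : (Num.floor x)%:~R <= x < (Num.floor x)%:~R + 1.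
  by have := Num.Theory.real_floor_itv (num_real x); rewrite intrD.
have S0 := lt_le_trans ltr01 S1.
have := fl (- (b%:~R * T + c%:~R * U) / S); rewrite -/a.
rewrite ler_pdivlMr // ltr_pdivrMr // => /andP[a1 a2].
have := fl cr; have := fl br; rewrite -/c -/b => /andP[b1 b2] /andP[c1 c2].
exists (g ^+ n * (ival a b c + y0)).
  have := lvl a b c; cbv zeta => -[+ _ _]; rewrite -[y0 in X in _ -> X]mul1r.
  apply=> //; have : (0 : R) <= (- (a * s + b * t + c * u))%:~R < S.
    by rewrite rmorphN !rmorphD !rmorphM /= -/S -/T -/U; lra.
  by rewrite /S -[0]/(0%:~R) ler_int ltr_int.
rewrite (_ : p = g ^+ n * p'); last by rewrite /p' mulrCA mulfV // mulr1.
rewrite -mulrBr normcM normcX mulrC ler_wpM2r ?exprn_ge0 ?normc_ge0 //.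
have -> : p' - (ival a b c + y0) =
   (ar - a%:~R)%:C%C + ((br - b%:~R)%:C%C * g + ((cr - c%:~R)%:C%C * g ^+ 2 - y0)).
  rewrite pE /ival /ar /br (conj_sqr tp).
  have ii (z : int) : (z%:~R : R[i]%C) = (z%:~R : R)%:C%C by rewrite rmorph_int.
  by rewrite !ii; ring.
have := le_normcD; rewrite /= => tri.
have n1 := conj_normc_bounds tp.
have nr (x : R) : normc x%:C%C = `|x| by rewrite /= expr0n addr0 sqrtr_sqr.
apply: le_trans (tri _ _ _) _; rewrite nr.
apply: (@le_trans _ _ (6 + (1 * 1 + (1 * 1 + 13 / 10)))); last by lra.
have g1 : normc g <= 1 by lra.
apply: lerD.
  have T01 : 0 <= T <= 2 * S by rewrite T2 andbT (le_trans _ T1) // ltW.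
  have U01 : 0 <= U <= 4 * S.
    have /andP[T0 _] := T01; rewrite (le_trans T0 U1) /= (le_trans U2) //.
    by rewrite (_ : 4 * S = 2 * (2 * S)) ?ler_pM2l // mulrA -natrM.
  have a12 : a%:~R * S <= - (b%:~R * T + c%:~R * U) < (a%:~R + 1) * S by rewrite a1.
  have b12 : b%:~R <= br < b%:~R + 1 by rewrite b1.
  have c12 : c%:~R <= cr < c%:~R + 1 by rewrite c1.
  exact: rounding_bound S0 T01 U01 h0 a12 b12 c12.
apply: le_trans (tri _ _ _) _; apply: lerD.
  by rewrite normcM nr ler_pM ?normc_ge0 // ger0_norm; lra.
apply: le_trans (tri _ _ _) _; rewrite normcN; apply: lerD (Fb Fy0).
rewrite normcM nr normcX ler_pM ?exprn_ge0 ?normc_ge0 //.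
  by rewrite ger0_norm; lra.
by rewrite exprn_ile1 ?normc_ge0.
Qed.

(** The coefficients of the shift in the real basis 1, g determine [u] and [v], so Xi is a lattice
    of rank 2; this makes the tiling locally finite. *)
Lemma shift_bounded (D : R) (e : bool) (u v : int) : normc (shift e u v) <= D ->
  `|u%:~R| <= 2 * D + 1 / 2 :> R /\ `|v%:~R| <= 2 * D + 1 / 2 :> R.
Proof.
move=> dD.
have ii (z : int) : (z%:~R : R[i]%C) = (z%:~R : R)%:C%C by rewrite rmorph_int.
have dE : shift e u v = (e%:R + u%:~R + v%:~R + v%:~R * (al ^+ 2 - al))%:C%C
     - (u%:~R + (1 - al) * v%:~R)%:C%C * g.
  rewrite /shift (conj_sqr tp) !ii.
  have -> : (e%:R : R[i]%C) = (e%:R : R)%:C%C by rewrite rmorph_nat.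
  by ring.
have n2 := normc_sqr (shift e u v).
have Reg := Re_conj tp; have Img := Im_conj_sqr tp; have ab := alpha_bounds tp.
have d2 : normc (shift e u v) ^+ 2 <= D ^+ 2.
  by rewrite ler_sqr ?nnegrE ?normc_ge0 // (le_trans _ dD) ?normc_ge0.
move: (d2); rewrite n2 dE.
have D0 : 0 <= D by apply: le_trans dD; exact: normc_ge0.
pose U : R := u%:~R; pose V : R := v%:~R; rewrite -/U -/V.
pose p := U + (1 - al) * V; pose q := e%:R + U + V + V * (al ^+ 2 - al).
rewrite -/p -/q; move: Reg Img; case: (g) => x y /= ex ey h.
have {}h : (q - p * x) ^+ 2 + p ^+ 2 * y ^+ 2 <= D ^+ 2.
  suff -> : (q - p * x) ^+ 2 + p ^+ 2 * y ^+ 2 =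
     (q - (p * x - 0 * y)) ^+ 2 + (0 - (p * y + 0 * x)) ^+ 2 by [].
  by clear; ring.
(* Numerically [y^2] is about 0.63; the factor 129/100 below exceeds the inverse square root of
   61/100. *)
have y1 : 61 / 100 <= y ^+ 2 by rewrite ey; nra.
have h1 : `|q - p * x| <= D.
  rewrite -ler_sqr ?nnegrE // real_normK ?num_real //; apply: le_trans h.
  by rewrite lerDl mulr_ge0 ?sqr_ge0.
have h2 : `|p| <= 129 / 100 * D.
  rewrite -ler_sqr ?nnegrE //; last by lra.
  rewrite real_normK ?num_real //.
  have := sqr_ge0 (q - p * x); have := sqr_ge0 p; nra.
have e1 : 0 <= (e%:R : R) <= 1 by case: (e); rewrite /= ?lexx ?ler01.
have qp : e%:R + V * al ^+ 2 = (q - p * x) - p * (1 - x) by rewrite /q /p; ring.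
have pU : U = p - (1 - al) * V by rewrite /p; ring.
clearbody p q U V.
move: h1 h2; rewrite !ler_norml => /andP[h1 h1'] /andP[h2 h2'].
have x1 : 0 <= 1 - x <= 1235 / 1000 by rewrite ex; lra.
have V1 : - (26 / 10 * D + 1) <= V * al ^+ 2 <= 26 / 10 * D + 1.
  have : - (16 / 10 * D) <= p * (1 - x) <= 16 / 10 * D by apply/andP; split; nra.
  by move=> h3; lra.
have s1 : 213 / 100 <= al ^+ 2 by nra.
have V2 : - (1221 / 1000 * D + 47 / 100) <= V <= 1221 / 1000 * D + 47 / 100.
  by move: V1 s1 D0; move: (al ^+ 2) => s; clear; move=> *; apply/andP; split; nra.
split; last by lra.
have V3 : `|(1 - al) * V| <= 47 / 100 * (1221 / 1000 * D + 47 / 100).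
  by rewrite normrM ler_pM // ler_norml; [lra|].
by move: V3; rewrite ler_norml pU; lra.
Qed.

Lemma mem_zbox (u : int) : `|u%:~R| < 6 :> R -> Z_of_int u \in zbox.
Proof.
rewrite ltr_norml => /andP[].
rewrite -[6 : R]/((6 : int)%:~R) -intrN !ltr_int => u1 u2.
apply/mapP; exists (Z.to_nat (Z.add (Z_of_int u) (Zpos 5))).
  by rewrite mem_iota; lia.
by lia.
Qed.

Lemma zr_Z_of_int (u : int) : zr (Z_of_int u) = u%:~R :> R.
Proof. by rewrite /zr Z_of_intK. Qed.

Lemma zeval_neighbour (e : bool) (u v : int) :
  zeval g (zneighbour e (Z_of_int u) (Z_of_int v)).2 = shift e u v.
Proof.
rewrite /zneighbour /zeval /= !(zrD, zrN) !zr_Z_of_int /shift.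
rewrite !(rmorphD, rmorphN) /= !rmorph_int.
have -> : int_of_Z (if e then Zpos 1 else Z0) = e%:Z by case: (e).
by rewrite -pmulrn; ring.
Qed.

Lemma covered_pair n (e : bool) (u v : int) :
  ~~ [&& ~~ e, u == 0 & v == 0] ->
  disc_covered g (fun x => F x /\ in_tile e u v x) n (11 * leaf_count n).
Proof.
move=> nz; set A := (fun x => _).
have [[x Ax]|A0] := pselect (exists x, A x); last first.
  apply: (@covered_sub _ _ _ tp _ (fun=> False) n n _ 0) => //.
    by move=> x Ax; apply: A0; exists x.
  by apply: covered_empty => x.
have sD : normc (shift e u v) <= 26 / 10.
  have [/Fb x1 [y /Fb y1 xE]] := Ax.
  have -> : shift e u v = x - (-1) ^+ e * y by rewrite xE addrK.
  apply: le_trans (le_normcD _ _) _.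
  by rewrite normcN normcM sign_normc mul1r; lra.
have [uD vD] := shift_bounded sD.
have ub : Z_of_int u \in zbox by apply: mem_zbox; lra.
have vb : Z_of_int v \in zbox by apply: mem_zbox; lra.
have nz' : ~~ (~~ e && (Z_of_int u == Z0) && (Z_of_int v == Z0)).
  by apply: contra nz => /andP[/andP[-> /eqP u0] /eqP v0] /=; lia.
apply: (covered_sub tp _ (leqnn n) (leqnn _)
  (covered_neighbour_box tp FE Fb n ub vb nz')).
move=> z [Fz [y Fy zE]]; split=> //; exists y => //.
by rewrite zeval_neighbour expr0 mulr1.
Qed.

End Covering.

(** * Topology of the tiles *)

Section PlaneMetric.
Context {R : realType}.
Implicit Types (A : set (plane R)) (x y p q : R[i]%C).

Definition has_ball A p r := forall y, normc (p - y) < r -> A y.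

(** The norm of the plane takes values in [R[i]]; this passes to the real-valued [normc]. *)
Lemma nbhs_planeP (x : plane R) A :
  nbhs x A <-> exists2 r : R, 0 < r & has_ball A x r.
Proof.
split.
  move=> /nbhs_ballP[e /= e0]; rewrite -ball_normE => eA.
  have eE : e = (complex.Re e)%:C%C by rewrite RRe_real // gtr0_real.
  exists (complex.Re e); first by move: e0; rewrite eE -[0]/(0%:C%C) ltcR.
  by move=> y xy; apply: eA => /=; rewrite eE -[`|_|]/((normc (x - y))%:C%C) ltcR.
move=> [r r0 rA]; apply/nbhs_ballP; exists r%:C%C; first by rewrite /= -[0]/(0%:C%C) ltcR.
rewrite -ball_normE => y /=; rewrite -[`|_|]/((normc (x - y : R[i]%C))%:C%C) ltcR.
exact: rA.
Qed.

Lemma open_planeP A : (forall x, A x -> exists2 r : R, 0 < r & has_ball A x r) <-> open A.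
Proof.
rewrite openE /interior; split=> h x /h; first by move=> hx; apply/nbhs_planeP.
by move=> /nbhs_planeP.
Qed.

Lemma closed_planeP A : closed A -> forall x, ~ A x ->
  exists2 r : R, 0 < r & forall y, normc (x - y) < r -> ~ A y.
Proof. by move=> /closed_openC/open_planeP cA x /cA. Qed.

Lemma open_disc p r : open [set y : plane R | normc (p - y) < r].
Proof.
apply/open_planeP => x /= xr; exists (r - normc (p - x)); first by rewrite subr_gt0.
move=> y xy /=; have -> : p - y = (p - x) + (x - y) by ring.
by apply: le_lt_trans (le_normcD _ _) _; rewrite addrC -ltrBrDr.
Qed.

Lemma compact_finite_cover A (f : nat -> set (plane R)) : compact A ->
  (forall n, open (f n)) -> (forall x, A x -> exists n, f n x) ->
  exists N, forall x, A x -> exists2 n, (n < N)%N & f n x.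
Proof.
rewrite compact_cover => cA fo fA.
have [|D' _ AD] := cA nat setT f (fun n _ => fo n).
  by move=> x /fA[n fx]; exists n.
exists (\max_(i <- finmap.enum_fset D') i).+1 => x /AD[n /= nD fx]; exists n => //.
by rewrite ltnS; apply: leq_bigmax_seq.
Qed.

Lemma compact_plane_bounded A : compact A -> exists M, forall x, A x -> normc x <= M.
Proof.
move=> cA; have [||N AN] := @compact_finite_cover A
  (fun n => [set y : plane R | normc (0 - y) < n%:R]) cA.
- by move=> n; apply: open_disc.
- move=> x _; exists (Num.bound (normc x)) => /=.
  by rewrite sub0r normcN; exact: archi_boundP (normc_ge0 x).
exists N%:R => x /AN[n nN /=]; rewrite sub0r normcN => /ltW /le_trans; apply.
by rewrite ler_nat ltnW.
Qed.

Lemma continuous_affine (u v : R[i]%C) : continuous (fun x : plane R => v + u * x : plane R).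
Proof.
move=> x A /nbhs_planeP[r r0 rA]; apply/nbhs_planeP.
have u1 : 0 < 1 + normc u by have := normc_ge0 u; lra.
exists (r / (1 + normc u)) => [|y xy]; first exact: divr_gt0.
apply: rA; rewrite (_ : _ - _ = u * (x - y)); last by ring.
rewrite normcM; apply: le_lt_trans (_ : (1 + normc u) * normc (x - y) < _).
  by rewrite ler_wpM2r ?normc_ge0 //; lra.
by rewrite mulrC -ltr_pdivlMr.
Qed.

Lemma compact_plane_closed A : compact A -> closed A.
Proof. by apply: compact_closed; exact: (@norm_hausdorff _ (plane R)). Qed.

Lemma expr_lt_eps (r e : R) : 0 <= r < 1 -> 0 < e -> exists n, r ^+ n < e.
Proof.
move=> /andP[r0 r1] e0; have := @cvg_expr R r.
rewrite ger0_norm // => /(_ r1) /cvgrPdist_lt /(_ e e0) [N _ /(_ N (leqnn _))] /=.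
by rewrite sub0r normrN ger0_norm ?exprn_ge0 // => h; exists N.
Qed.

End PlaneMetric.

Section TileTopology.
Context {R : realType} {al : R} {g : R[i]%C}.
Hypothesis tp : tent_pair al g.
Context {F : set (plane R)}.
Hypothesis FE : tent_set g F.
Hypothesis cF : compact F.

(** The constant is the c with [c (1 + 13/10) = 13/10], so that R maps the disc of radius 13/10 into
    itself. *)
Lemma conj_normc3 : normc g ^+ 3 <= 13 / 23.
Proof.
have [a3 _ _] := tp; have ab := alpha_bounds tp.
rewrite -ler_sqr ?nnegrE ?exprn_ge0 ?normc_ge0 //.
have -> : (normc g ^+ 3) ^+ 2 = (normc g ^+ 2) ^+ 3 by ring.
rewrite (conj_normc_sqr tp) -(alphaV tp) exprVn a3 invf_ple ?posrE //; nra.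
Qed.

(** Compactness provides some bound; each use of the set equation multiplies its excess over 13/10
    by at most [|g|]. *)
Lemma tile_bounded x : F x -> normc x <= 13 / 10.
Proof.
have [M FM] := compact_plane_bounded cF.
have /andP[g0 g1] := conj_normc_bounds tp.
have Fn n : forall y, F y -> normc y <= 13 / 10 + normc g ^+ n * `|M|.
  elim: n => [|n IHn] y.
    by move=> /FM yM; rewrite mul1r (le_trans yM) // (le_trans (ler_norm M)) // lerDr.
  rewrite exprS -mulrA; move: IHn; set r := _ ^+ n * _ => IHn.
  have r0 : 0 <= r by rewrite mulr_ge0 ?exprn_ge0 ?normc_ge0.
  move=> /FE[] [z /IHn zr ->]; rewrite normcM.
    by move: (normc z) zr => {}z zr; nra.
  rewrite normcX; have z1 : normc (1 - z) <= 23 / 10 + r.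
    by apply: le_trans (le_normcD _ _) _; rewrite normcN normc1; lra.
  have c3 := conj_normc3.
  have c1 : normc g ^+ 3 <= normc g.
    by rewrite exprS ler_piMr ?normc_ge0 ?exprn_ile1 ?normc_ge0 //; lra.
  apply: (@le_trans _ _ (normc g ^+ 3 * (23 / 10 + r))).
    by rewrite ler_wpM2l ?exprn_ge0 ?normc_ge0.
  have := ler_wpM2r r0 c1; lra.
move=> Fx; rewrite leNgt; apply/negP => x1.
have M1 : 0 < 1 + `|M| by rewrite ltr_pwDl.
have [n gn] : exists n, normc g ^+ n < (normc x - 13 / 10) / (1 + `|M|).
  by apply: expr_lt_eps; [lra | rewrite divr_gt0 // subr_gt0].
have := Fn n x Fx; move: gn; rewrite ltr_pdivlMr // mulrDr mulr1.
have : 0 < normc g ^+ n by rewrite exprn_gt0; lra.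
lra.
Qed.

Lemma tile_closed (e : bool) (u v : int) :
  closed (in_tile g F e u v : set (plane R)).
Proof.
apply: compact_plane_closed.
have -> : (in_tile g F e u v : set (plane R)) =
    (fun x : plane R => shift g e u v + (-1) ^+ e * x : plane R) @` F.
  by apply/seteqP; split=> x /= [y Fy xE]; exists y.
apply: continuous_compact => //; apply: continuous_subspaceT.
exact: continuous_affine.
Qed.

Definition box (D : nat) : seq (bool * (int * int)) :=
  let s := [seq Posz k - Posz D | k <- iota 0 (D + D).+1] in
  [seq (e, p) | e <- [:: false; true], p <- [seq (u, v) | u <- s, v <- s]].

Lemma mem_box D e (u v : int) : `|u| <= D%:Z -> `|v| <= D%:Z -> (e, (u, v)) \in box D.
Proof.
have mem (w : int) : `|w| <= D%:Z -> w \in [seq Posz k - Posz D | k <- iota 0 (D + D).+1].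
  by move=> wD; apply/mapP; exists (absz (w + D%:Z)); [rewrite mem_iota; lia | lia].
move=> /mem uD /mem vD; apply/allpairsP; exists (e, (u, v)); split; [by case: (e)| |by []].
by apply/allpairsP; exists (u, v); split.
Qed.

Lemma tile_near (M : R) : exists D : nat, forall e u v x, in_tile g F e u v x ->
  normc x <= M -> (e, (u, v)) \in box D.
Proof.
exists (Num.bound (2 * (M + 13 / 10) + 1 / 2)) => e u v x [y /tile_bounded y1 xE] xM.
have dD : normc (shift g e u v) <= M + 13 / 10.
  have -> : shift g e u v = x - (-1) ^+ e * y by rewrite xE addrK.
  apply: le_trans (le_normcD _ _) _.
  by rewrite normcN normcM sign_normc mul1r; lra.
have M0 : 0 <= 2 * (M + 13 / 10) + 1 / 2.
  by have := le_trans (normc_ge0 _) dD; lra.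
have [uD vD] := shift_bounded tp dD.
have D1 := archi_boundP M0.
by apply: mem_box; rewrite -(ler_int R) intr_norm; apply: le_trans (ltW D1).
Qed.

(** By local finiteness the union of any subfamily of tiles is closed, so a point outside it has a
    positive distance from it. *)
Lemma separation (p : R[i]%C) (S : bool * (int * int) -> Prop) :
  (forall e u v, S (e, (u, v)) -> ~ in_tile g F e u v p) ->
  exists2 r : R, 0 < r & forall e u v q, S (e, (u, v)) -> in_tile g F e u v q ->
    r <= normc (p - q).
Proof.
move=> Sp; have [D nearD] := tile_near (normc p + 1).
have [r r0 rS] : exists2 r : R, 0 < r & {in box D, forall i, S i ->
    forall q, in_tile g F i.1 i.2.1 i.2.2 q -> r <= normc (p - q)}.
  elim: (box D) => [|[e [u v]] l [r r0 rl]]; first by exists 1.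
  have [Si|nSi] := pselect (S (e, (u, v))); last first.
    by exists r => // i; rewrite inE => /orP[/eqP -> //|/rl].
  have [r' r'0 r'F] := closed_planeP (@tile_closed e u v) (Sp _ _ _ Si).
  exists (Num.min r r') => [|i]; first by rewrite lt_min r0.
  rewrite inE => /orP[/eqP -> _ q /= qi|/rl il Si' q qi]; rewrite ge_min.
    by apply/orP; right; rewrite leNgt; apply/negP => /r'F.
  by rewrite il.
exists (Num.min r 1) => [|e u v q Si qi]; first by rewrite lt_min r0 ltr01.
rewrite ge_min; have [pq|/ltW ->] := leP (normc (p - q)) 1; last by rewrite orbT.
rewrite (rS (e, (u, v))) //; apply: nearD qi _.
have -> : q = p - (p - q) by ring.
by apply: le_trans (le_normcD _ _) _; rewrite normcN lerD2l.
Qed.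

Lemma tiles_cover (p : R[i]%C) : F !=set0 -> in_tiles g F p.
Proof.
move=> F0; apply: contrapT => np.
have [|r r0 rF] := @separation p (fun=> True).
  by move=> e u v _ pe; apply: np; exists e, u, v.
have /andP[g0 g1] := conj_normc_bounds tp.
have [n gn] : exists n, normc g ^+ n < r / 10.
  by apply: expr_lt_eps; [lra | rewrite divr_gt0].
have [q [e [u [v qi]]] pq] := in_tiles_dense tp FE tile_bounded p n F0.
by have := rF e u v q I qi; lra.
Qed.

(** If F contains no disc, neither does any tile; as tiles are closed, a disc can be shrunk to avoid
    finitely many of them one after the other. Near 0 this would contradict the covering. *)
Lemma no_ball_avoid (l : seq (bool * (int * int))) p (r : R) : 0 < r ->
  (forall q s, 0 < s -> ~ has_ball F q s) ->
  exists q s, [/\ 0 < s, forall y, normc (q - y) < s -> normc (p - y) < r &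
    {in l, forall i, forall y, normc (q - y) < s -> ~ in_tile g F i.1 i.2.1 i.2.2 y}].
Proof.
move=> r0 nF; elim: l => [|[e [u v]] l [q [s [s0 sp sl]]]].
  by exists p, r; split.
have [x qx xi] : exists2 x, normc (q - x) < s & ~ in_tile g F e u v x.
  apply: contrapT => h; apply: (nF ((-1) ^+ e * (q - shift g e u v)) s s0) => y qy.
  have [y' Fy'] : in_tile g F e u v (shift g e u v + (-1) ^+ e * y).
    apply: contrapT => h'; apply: h; exists (shift g e u v + (-1) ^+ e * y) => //.
    move: qy; rewrite -(mul1r (normc (q - _))) -(sign_normc e) -normcM.
    have -> // : (-1) ^+ e * (q - (shift g e u v + (-1) ^+ e * y)) =
      (-1) ^+ e * (q - shift g e u v) - y.
    by move: (shift g e u v) => d; clear; case: e => /=; ring.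
  by move=> /addrI /(mulfI _) -> //; case: (e); rewrite /= ?oppr_eq0 oner_eq0.
have [s' s'0 s'F] := closed_planeP (@tile_closed e u v) xi.
exists x, (Num.min s' (s - normc (q - x))); split.
- by rewrite lt_min s'0 subr_gt0.
- move=> y; rewrite lt_min => /andP[_ xy]; apply: sp.
  rewrite (_ : q - y = (q - x) + (x - y)); last by ring.
  by apply: le_lt_trans (le_normcD _ _) _; rewrite addrC -ltrBrDr.
- move=> i; rewrite inE => /orP[/eqP -> /= y|il y]; rewrite lt_min => /andP[xy xy'].
    exact: s'F.
  apply: sl => //; rewrite (_ : q - y = (q - x) + (x - y)); last by ring.
  by apply: le_lt_trans (le_normcD _ _) _; rewrite addrC -ltrBrDr.
Qed.

Lemma tile_has_ball : F !=set0 -> exists p r, 0 < r /\ has_ball F p r.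
Proof.
move=> F0; apply: contrapT => nF.
have [D nearD] := tile_near 1.
have [|q [s [s0 sp sl]]] := @no_ball_avoid (box D) 0 1 ltr01.
  by move=> q s s0 qs; apply: nF; exists q, s.
have [e [u [v qi]]] := tiles_cover q F0.
have q1 : normc (q - q) < s by rewrite subrr normc0.
apply: (sl (e, (u, v)) _ q) => //; apply: nearD qi _.
by have := sp q q1; rewrite sub0r normcN => /ltW.
Qed.

Lemma tile_subpiece n q : F q -> exists u v : R[i]%C,
  [/\ 0 < normc u, normc u <= normc g ^+ n, forall y, F y -> F (u * y + v) &
    exists2 y, F y & q = u * y + v].
Proof.
have g0 := conj_normc_gt0 tp; have /andP[_ g1] := conj_normc_bounds tp.
elim: n q => [|n IHn] q Fq.
  exists 1, 0; rewrite normc1 expr0; split=> // [y Fy|]; first by rewrite mul1r addr0.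
  by exists q; rewrite // mul1r addr0.
have [[y Fy ->]|[y Fy ->]] := (FE q).1 Fq;
    have [u [v [u0 un uF [z Fz ->]]]] := IHn y Fy.
  exists (g * u), (g * v); rewrite normcM exprS; split.
  - exact: mulr_gt0.
  - by rewrite ler_wpM2l // ltW.
  - by move=> x /uF Fx; apply/FE; left; exists (u * x + v) => //; ring.
  - by exists z => //; ring.
exists (- g ^+ 3 * u), (g ^+ 3 * (1 - v)); rewrite normcM normcN normcX; split.
- by rewrite mulr_gt0 // exprn_gt0.
- rewrite [normc g ^+ n.+1]exprS ler_pM ?exprn_ge0 ?normc_ge0 //.
  by rewrite exprS ler_piMr ?exprn_ile1 ?normc_ge0 //; lra.
- by move=> x /uF Fx; apply/FE; right; exists (u * x + v) => //; ring.
- by exists z => //; ring.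
Qed.

(** F is the closure of its interior: [q] lies in an arbitrarily small copy of F inside F, and that
    copy contains a disc. *)
Lemma tile_small_ball q (r : R) : F q -> 0 < r -> exists p s, [/\ 0 < s,
  has_ball F p s & forall y, normc (p - y) < s -> normc (q - y) < r].
Proof.
move=> Fq r0; have [p [s [s0 sF]]] := tile_has_ball (ex_intro _ q Fq).
have [p' [s' [s'0 s'F s'3]]] : exists p s, [/\ 0 < s, has_ball F p s & s <= 1].
  exists p, (Num.min s 1); split; first by rewrite lt_min s0 ltr01.
    by move=> y; rewrite lt_min => /andP[/sF].
  by rewrite ge_min lexx orbT.
have /andP[g0 g1] := conj_normc_bounds tp.
have [n gn] : exists n, normc g ^+ n < r / 10.
  by apply: expr_lt_eps; [lra | rewrite divr_gt0].
have [u [v [u0 un uF [z Fz qE]]]] := tile_subpiece n Fq.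
have un0 : u != 0 by apply: contraTneq u0 => ->; rewrite normc0 ltxx.
exists (u * p' + v), (normc u * s'); split; first exact: mulr_gt0.
  move=> y py; rewrite (_ : y = u * ((y - v) / u) + v).
    apply: uF; apply: s'F; rewrite -(ltr_pM2l u0) -normcM mulrBr.
    by rewrite (_ : u * _ - u * _ = u * p' + v - y) // mulrCA mulfV // mulr1; ring.
  by rewrite mulrCA mulfV // mulr1 subrK.
move=> y py; have Fp : F p' by apply: s'F; rewrite subrr normc0.
rewrite (_ : q - y = u * (z - p') + (u * p' + v - y)); last by rewrite qE; ring.
apply: le_lt_trans (le_normcD _ _) _; rewrite normcM.
have zp : normc (z - p') <= 26 / 10.
  apply: le_trans (le_normcD _ _) _; rewrite normcN.
  by have := tile_bounded Fp; have := tile_bounded Fz; lra.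
by have := normc_ge0 (z - p'); nra.
Qed.

End TileTopology.

(** * Overlaps are null sets *)

Section PlaneMeasure.
Context {R : realType} {g : R[i]%C}.
Implicit Types (A : R[i]%C -> Prop).

Local Notation mu2 := ((@lebesgue_measure R) \x (@lebesgue_measure R))%E.

(** Squares enclose the discs of a covering and have an immediate product measure. *)
Definition square (c : R[i]%C) (r : R) : set (R * R) :=
  `[complex.Re c - r, complex.Re c + r]%classic `*`
  `[complex.Im c - r, complex.Im c + r]%classic.

Lemma square_measurable c r : measurable (square c r).
Proof. by apply: measurableX; exact: measurable_itv. Qed.

Lemma square_measure c r : 0 < r -> mu2 (square c r) = ((2 * r) ^+ 2)%:E.
Proof.
move=> r0; rewrite /square product_measure1E; [|exact: measurable_itv..].
have side (x : R) : lebesgue_measure (`[x - r, x + r]%classic : set R) = (2 * r)%:E.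
  rewrite lebesgue_measure_itv /= lte_fin ifT; last by lra.
  by rewrite -EFinB; congr (_%:E); ring.
by rewrite [X in (X * _)%E]side [X in (_ * X)%E]side -EFinM expr2.
Qed.

Lemma disc_square (c x : R[i]%C) (r : R) : normc (x - c) <= r ->
  square c r (complex.Re x, complex.Im x).
Proof.
have := normc_sqr (x - c); have := normc_ge0 (x - c).
case: x c => [x y] [a b] /= n0 n2 nr.
have nr2 : normc ((x - a) +i* (y - b))%C ^+ 2 <= r ^+ 2.
  by rewrite ler_sqr ?nnegrE ?(le_trans _ nr) ?normc_ge0.
have r0 : 0 <= r by exact: le_trans nr.
have sq (z w : R) : z ^+ 2 + w ^+ 2 <= r ^+ 2 -> - r <= z <= r.
  move=> zw; rewrite -ler_norml -ler_sqr ?nnegrE // real_normK ?num_real //.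
  by apply: le_trans zw; rewrite lerDl sqr_ge0.
have h : (x - a) ^+ 2 + (y - b) ^+ 2 <= r ^+ 2 by rewrite -n2.
have h' : (y - b) ^+ 2 + (x - a) ^+ 2 <= r ^+ 2 by rewrite addrC.
have := sq _ _ h; have := sq _ _ h'.
by move=> /andP[h1 h2] /andP[h3 h4]; split; rewrite /= in_itv /=; apply/andP; split; lra.
Qed.

Lemma discs_measure (s : seq R[i]%C) (r : R) : 0 < r -> exists U : set (R * R),
  [/\ measurable U, (mu2 U <= ((size s)%:R * (2 * r) ^+ 2)%:E)%E &
    forall x c, c \in s -> normc (x - c) <= r -> U (complex.Re x, complex.Im x)].
Proof.
move=> r0; elim: s => [|c s [U [mU Us Uin]]].
  by exists set0; split=> //; rewrite measure0 mul0r.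
exists (square c r `|` U); split.
- by apply: measurableU => //; exact: square_measurable.
- apply: le_trans (measureU2 _ _ _) _ => //; first exact: square_measurable.
  rewrite /= -addn1 natrD mulrDl mul1r EFinD addeC; apply: leeD => //.
  by rewrite square_measure.
- move=> x c'; rewrite inE => /orP[/eqP ->|c's] xc; last by right; exact: (Uin x c').
  by left; exact: disc_square.
Qed.

Lemma negligible_covered A (N : nat -> nat) : 0 < normc g ->
  (forall n, disc_covered g A n (N n)) ->
  (forall e : R, 0 < e -> exists n, (N n)%:R * (26 / 10 * normc g ^+ n) ^+ 2 < e) ->
  (mu2).-negligible [set p : R * R | A (p.1 +i* p.2)%C].
Proof.
move=> g0 AN N0.
have step (k : nat) : exists U : set (R * R), [/\ measurable U,
    (mu2 U <= (k.+1%:R^-1)%:E)%E & [set p : R * R | A (p.1 +i* p.2)%C] `<=` U].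
  have [n nk] := N0 k.+1%:R^-1 ltac:(by rewrite invr_gt0).
  have [c cN cA] := AN n.
  have r0 : 0 < 13 / 10 * normc g ^+ n by rewrite mulr_gt0 ?exprn_gt0.
  have [U [mU Us Uin]] := discs_measure c r0.
  exists U; split=> //.
    apply: le_trans Us _; rewrite lee_fin; apply: le_trans (ltW nk).
    rewrite (_ : 2 * (13 / 10 * normc g ^+ n) = 26 / 10 * normc g ^+ n); last by field.
    by rewrite ler_wpM2r ?sqr_ge0 // ler_nat.
  by move=> [x y] /= /cA[p pc xp]; have := Uin _ _ pc xp.
have [U hU] := choice step.
exists (\bigcap_k U k); split.
- by apply: bigcapT_measurable => k; have [] := hU k.
- apply/eqP; rewrite eq_le measure_ge0 andbT; apply/lee_addgt0Pr => e e0.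
  have [k ke] : exists k : nat, k.+1%:R^-1 <= e.
    exists (Num.bound e^-1); rewrite invf_ple ?posrE //.
    have e1 : 0 <= e^-1 by rewrite invr_ge0 ltW.
    by apply: le_trans (ltW (archi_boundP e1)) _; rewrite ler_nat.
  have [mU Uk _] := hU k; rewrite add0e.
  apply: (@le_trans _ _ (mu2 (U k))); last by apply: le_trans Uk _; rewrite lee_fin.
  apply: le_measure; rewrite ?inE //; last by move=> x /(_ k I).
  by apply: bigcapT_measurable => j; have [] := hU j.
- by move=> x Ax k _; have [_ _] := hU k; apply.
Qed.

Lemma negligible_no_ball A p (r : R) : (mu2).-negligible [set p : R * R | A (p.1 +i* p.2)%C] ->
  0 < r -> ~ has_ball (A : set (plane R)) p r.
Proof.
move=> [U [mU U0 AU]] r0 hA.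
have : (mu2 (square p (r / 4)) <= mu2 U)%E.
  apply: le_measure; rewrite ?inE //; first exact: square_measurable.
  move=> [x y] [/=]; rewrite !in_itv /= => /andP[x1 x2] /andP[y1 y2].
  apply: AU => /=; apply: hA; rewrite -ltr_sqr ?nnegrE ?normc_ge0 ?ltW //.
  rewrite normc_sqr; case: p x1 x2 y1 y2 => a b /= x1 x2 y1 y2; nra.
rewrite U0 square_measure ?divr_gt0 // lee_fin leNgt; move/negP; apply.
by rewrite exprn_gt0 // mulr_gt0 // divr_gt0.
Qed.

End PlaneMeasure.

Definition in_tile_at (R : realType) (g : R[i]%C) (F : R[i]%C -> Prop)
  (i : bool * (int * int)) := in_tile g F i.1 i.2.1 i.2.2.

Section TilesDisjoint.
Context {R : realType} {al : R} {g : R[i]%C}.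
Hypothesis tp : tent_pair al g.
Context {F : set (plane R)}.
Hypothesis FE : tent_set g F.
Hypothesis cF : compact F.

Local Notation mu2 := ((@lebesgue_measure R) \x (@lebesgue_measure R))%E.

Local Notation in_tile_at := (in_tile_at g F).

(** The isometry that carries F to the tile [i] reduces the pair to F and one neighbour. *)
Lemma covered_tiles (i j : bool * (int * int)) n : i <> j ->
  disc_covered g (fun x => in_tile_at i x /\ in_tile_at j x) n (11 * leaf_count n).
Proof.
case: i j => e [u v] [e' [u' v']] ij.
pose u2 := if e then u - u' else u' - u; pose v2 := if e then v - v' else v' - v.
have rel : shift g e' u' v' = shift g e u v + (-1) ^+ e * shift g (e (+) e') u2 v2.
  rewrite /shift /u2 /v2; case: (e); case: (e'); rewrite /= ?rmorphB /=; ring.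
apply: (@covered_affine _ _ _ tp _
  (fun x => F x /\ in_tile g F (e (+) e') u2 v2 x) ((-1) ^+ e) (shift g e u v) 0).
- by rewrite sign_normc.
- move=> x [[y Fy xy] [y' Fy' xy']]; exists y; last by rewrite addrC.
  split=> //; exists y' => //.
  have e0 : (-1) ^+ e != 0 :> R[i]%C by rewrite signr_eq0.
  apply: (mulfI e0); apply: (addrI (shift g e u v)).
  rewrite -xy xy' rel /= [(-1) ^+ e * (shift _ _ _ _ + _)]mulrDr addrA; congr (_ + _).
  by rewrite mulrA -signr_addb addbA addbb addFb.
- rewrite subn0; apply: (covered_pair tp FE (tile_bounded tp FE cF)).
  apply/negP => /and3P[ee /eqP u0 /eqP v0]; apply: ij.
  move: ee u0 v0; rewrite /u2 /v2; case: (e); case: (e') => //= _ u0 v0;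
    congr (_, (_, _)); lia.
Qed.

Lemma cover_area_small (e : R) : 0 < e ->
  exists n, (11 * leaf_count n)%:R * (26 / 10 * normc g ^+ n) ^+ 2 < e.
Proof.
move=> e0; have /andP[g0 g1] := conj_normc_bounds tp.
(* The rational 5/4 is above mu and meets the hypothesis of [leaf_count_le]; 125/144 is
   [5/4 (5/6)^2], where [|g| < 5/6]. The constant [200^2] exceeds [11 * 256 * (26/10)^2]. *)
have [n gn] : exists n, (125 / 144) ^+ n < e / 200 ^+ 2 :> R.
  by apply: expr_lt_eps; [lra | rewrite divr_gt0].
exists n; have lc := @leaf_count_le R (5 / 4) n ltac:(lra) ltac:(lra).
have gg : normc g ^+ n <= (5 / 6) ^+ n by rewrite lerXn2r ?nnegrE ?normc_ge0; lra.
have c0 : 0 <= (leaf_count n)%:R :> R by [].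
have n0 : 0 <= normc g ^+ n by rewrite exprn_ge0 ?normc_ge0.
apply: (@le_lt_trans _ _ (11 * (256 * (5 / 4) ^+ n) * ((26 / 10) ^+ 2 * ((5 / 6) ^+ n) ^+ 2))).
  rewrite natrM exprMn ler_pM ?mulr_ge0 ?sqr_ge0 //; first by rewrite ler_pM2l.
  by rewrite ler_pM2l ?exprn_gt0 // ?ler_sqr ?nnegrE // exprn_ge0.
have pw : (5 / 4) ^+ n * ((5 / 6) ^+ n) ^+ 2 = (125 / 144) ^+ n :> R.
  by rewrite -[(_ ^+ n) ^+ 2]exprM mulnC exprM -exprMn; congr (_ ^+ n); field.
move: gn pw; rewrite ltr_pdivlMr //.
have : 0 <= (125 / 144 : R) ^+ n by rewrite exprn_ge0.
move: ((125 / 144 : R) ^+ n) ((5 / 4 : R) ^+ n) (((5 / 6 : R) ^+ n) ^+ 2).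
move=> q a b q0 q1 ab.
have -> : 11 * (256 * a) * ((26 / 10) ^+ 2 * b) = (11 * 256 * (26 / 10) ^+ 2) * q.
  by rewrite -ab; ring.
lra.
Qed.

Lemma negligible_tiles (i j : bool * (int * int)) : i <> j ->
  (mu2).-negligible [set p : R * R | in_tile_at i (p.1 +i* p.2)%C /\
                                     in_tile_at j (p.1 +i* p.2)%C].
Proof.
move=> ij; apply: (@negligible_covered _ g
  (fun x => in_tile_at i x /\ in_tile_at j x) (fun n => 11 * leaf_count n)%N).
- exact: conj_normc_gt0 tp.
- by move=> n; exact: covered_tiles.
- exact: cover_area_small.
Qed.

Lemma tiles_ae : {ae mu2, forall p : R * R, forall i j,
  in_tile_at i (p.1 +i* p.2)%C -> in_tile_at j (p.1 +i* p.2)%C -> i = j}.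
Proof.
pose T := ((bool * (int * int)) * (bool * (int * int)))%type.
pose B (k : nat) : set (R * R) := [set p | exists2 ij : T, unpickle k = Some ij & ij.1 <> ij.2 /\
   (in_tile_at ij.1 (p.1 +i* p.2)%C /\ in_tile_at ij.2 (p.1 +i* p.2)%C)].
suff : (mu2).-negligible (~` [set p : R * R | forall i j,
    in_tile_at i (p.1 +i* p.2)%C -> in_tile_at j (p.1 +i* p.2)%C -> i = j]) by [].
apply: (@negligibleS _ _ R mu2 (\bigcup_k B k)).
  move=> p /= np; apply: contrapT => nB; apply: np => i j pi pj.
  apply: contrapT => ij; apply: nB; exists (pickle (i, j)) => //.
  by exists (i, j); rewrite ?pickleK.
apply: (@negligible_bigcup _ _ R mu2) => k; rewrite /B.
case: (unpickle k) => [[i j]|]; last first.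
  by apply: (@negligibleS _ _ R mu2 set0); [move=> p [] | exact: negligible_set0].
have [ij|ij] := pselect (i = j).
  by apply: (@negligibleS _ _ R mu2 set0); [move=> p [_ [<-] []] | exact: negligible_set0].
by apply: (@negligibleS _ _ R mu2) (negligible_tiles ij) => p [_ [<-] [_]].
Qed.

Lemma tile_pair_no_ball (i j : bool * (int * int)) p (r : R) : i <> j -> 0 < r ->
  ~ has_ball (fun x => in_tile_at i x /\ in_tile_at j x) p r.
Proof.
move=> ij r0; apply: negligible_no_ball r0.
exact: (negligible_tiles ij).
Qed.

End TilesDisjoint.

(** * Upper bound for the dimension *)

Section Boundary.
Context {R : realType} {al : R} {g : R[i]%C}.
Hypothesis tp : tent_pair al g.
Context {F : set (plane R)}.
Hypothesis FE : tent_set g F.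
Hypothesis cF : compact F.
Hypothesis F0 : F !=set0.

Let home : bool * (int * int) := (false, (0, 0)).

Lemma in_tile_home x : in_tile_at g F home x <-> F x.
Proof.
have s0 : shift g false 0 0 = 0 by rewrite /shift /= !mulr0z !mul0r !addr0.
rewrite /in_tile_at /in_tile /= s0.
split=> [[y Fy ->]|Fx]; first by rewrite expr0 mul1r add0r.
by exists x; rewrite // expr0 mul1r add0r.
Qed.

(** A point of F in no other tile has a disc around it that misses all other tiles; as the tiles
    cover the plane, this disc lies in F. *)
Lemma boundary_neighbour x : boundary F x -> exists i, i <> home /\
  F x /\ in_tile_at g F i x.
Proof.
move=> [Fx nx]; have {}Fx : F x.
  by move: Fx; rewrite -((closure_id F).1 (compact_plane_closed cF)).
apply: contrapT => h; apply: nx.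
have [|r r0 rS] := @separation R al g tp F FE cF x (fun i => i <> home).
  by move=> e u v ne xi; apply: h; exists (e, (u, v)).
apply/nbhs_planeP; exists r => // y xy.
have [e [u [v yi]]] := tiles_cover tp FE cF y F0.
have [eh|ne] := pselect ((e, (u, v)) = home).
  by apply/in_tile_home; rewrite -eh.
by have := rS e u v y ne yi; rewrite leNgt xy.
Qed.

(** If [x] were interior to F, a small disc of F near [1 - x] would reflect to a disc near [x]
    inside both F and [1 - F], whose intersection is null. *)
Lemma overlap_boundary x : F x -> F (1 - x) -> boundary F x.
Proof.
move=> Fx Fx'; split; first exact: subset_closure.
move=> /nbhs_planeP[r r0 rF].
have [p [s [s0 sF sr]]] := tile_small_ball tp FE cF Fx' r0.
have ne : home <> (true, (0, 0)) by [].
apply: (tile_pair_no_ball tp FE cF (p := 1 - p) ne s0) => y py; split.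
  apply/in_tile_home; apply: rF.
  rewrite (_ : x - y = - ((1 - x) - (1 - y))); last by ring.
  by rewrite normcN; apply: sr; rewrite -normcN (_ : - _ = 1 - p - y) //; ring.
rewrite /in_tile_at /=; exists (1 - y).
  by apply: sF; rewrite -normcN (_ : - _ = 1 - p - y) //; ring.
by rewrite /shift /= !mulr0z !mul0r !addr0 expr1; ring.
Qed.

Lemma covered_boundary : exists K : nat, forall n,
  disc_covered g (boundary F) n (K * (11 * leaf_count n)).
Proof.
have [D nearD] := tile_near tp FE cF (13 / 10).
exists (size (box D)) => n.
have [c cN cD] : exists2 c : seq R[i]%C, (size c <= size (box D) * (11 * leaf_count n))%N &
    {in box D, forall i, i <> home -> forall x, F x -> in_tile_at g F i x ->
      exists2 p, p \in c & normc (x - p) <= 13 / 10 * normc g ^+ n}.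
  elim: (box D) => [|i l [c cN cl]]; first by exists [::].
  have [ih|ih] := pselect (i = home).
    exists c; first by rewrite (leq_trans cN) // leq_mul2r leqnSn orbT.
    by move=> j; rewrite inE => /orP[/eqP -> /(_ ih)|/cl].
  have [c' c'N c'i] := covered_tiles tp FE cF n (nesym ih).
  exists (c' ++ c); first by rewrite size_cat mulSn leq_add.
  move=> j; rewrite inE => /orP[/eqP -> _ x Fx xi|jl jh x Fx xj].
    have [|p pc xp] := c'i x; first by split=> //; apply/in_tile_home.
    by exists p; rewrite // mem_cat pc.
  by have [p pc xp] := cl j jl jh x Fx xj; exists p; rewrite // mem_cat pc orbT.
exists c => // x /boundary_neighbour[[e [u v]] [ih [Fx xi]]].
exact: (cD _ (nearD _ _ _ _ xi (tile_bounded tp FE cF Fx)) ih x Fx xi).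
Qed.

End Boundary.

(** * Hausdorff measure estimated by coverings with discs *)

Section HausdorffUpper.
Context {R : realType}.
Implicit Types (A : set (plane R)).
Local Open Scope ereal_scope.

Lemma diam_ge0 A : 0 <= diam A.
Proof. by apply: ereal_sup_ubound; left. Qed.

Lemma diam_le A (r : R) : (0 <= r)%R ->
  (forall x y : R[i]%C, A x -> A y -> (normc (x - y) <= r)%R) -> diam A <= r%:E.
Proof.
move=> r0 Ar; apply: ge_ereal_sup => _ [->|[x Ax [y Ay <-]]]; first by rewrite lee_fin.
by rewrite lee_fin; exact: Ar.
Qed.

Lemma premeasure_covered A (s delta r : R) (c : seq R[i]%C) :
  (0 < s)%R -> (0 <= r)%R -> (2 * r <= delta)%R ->
  (forall x, A x -> exists2 p, p \in c & (normc (x - p) <= r)%R) ->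
  hausdorff_premeasure s delta A <= ((size c)%:R * (2 * r) `^ s)%:E.
Proof.
move=> s0 r0 rd cA.
pose U (k : nat) : set (plane R) :=
  [set x | (k < size c)%N /\ (normc (x - nth 0%R c k) <= r)%R].
have Ur k : diam (U k) <= (if (k < size c)%N then 2 * r else 0)%R%:E.
  case: ifP => kc; last by apply: diam_le => // x y [] /=; rewrite kc.
  apply: diam_le => [|x y [_ xr] [_ yr]]; first by rewrite mulr_ge0.
  rewrite (_ : x - y = (x - nth 0 c k) + - (y - nth 0 c k))%R; last by ring.
  by apply: le_trans (le_normcD _ _) _; rewrite normcN mulr_natl mulr2n lerD.
have Us k : diam (U k) `^ s <= (if (k < size c)%N then (2 * r) `^ s else 0)%R%:E.
  apply: le_trans (gt0_ler_poweR (ltW s0) _ _ (Ur k)) _.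
  - by rewrite in_itv /= diam_ge0 leey.
  - by rewrite in_itv /= leey andbT; case: ifP; rewrite lee_fin // mulr_ge0.
  - by rewrite poweR_EFin; case: ifP => //; rewrite powR0 // gt_eqF.
apply: (@le_trans _ _ (\sum_(k <oo) diam (U k) `^ s)).
  apply: ereal_inf_lbound; exists U => //; split.
    move=> x /cA[p pc xp]; exists (index p c) => //; split; rewrite ?index_mem //.
    by rewrite nth_index.
  move=> k; apply: le_trans (Ur k) _; rewrite lee_fin; case: ifP => // _.
  by apply: le_trans rd; rewrite mulr_ge0.
apply: lime_le; first by apply: is_cvg_nneseries => k _ _; exact: poweR_ge0.
apply: nearW => m.
apply: (@le_trans _ _ ((minn m (size c))%:R * (2 * r) `^ s)%:E); last first.
  by rewrite lee_fin ler_wpM2r ?powR_ge0 // ler_nat geq_minr.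
elim: m => [|m IHm]; first by rewrite big_nil min0n mul0r.
rewrite big_nat_recr //=; apply: le_trans (leeD IHm (Us m)) _.
rewrite -EFinD lee_fin; case: ifP => mc.
  rewrite (minn_idPl (ltnW mc) : minn m (size c) = m) (minn_idPl mc : minn m.+1 (size c) = m.+1).
  by rewrite [m.+1%:R]mulrSr [leRHS]mulrDl mul1r.
by rewrite addr0 ler_wpM2r ?powR_ge0 // ler_nat leq_min geq_min leqnSn geq_minr.
Qed.

Lemma premeasure_ge0 A (s delta : R) : 0 <= hausdorff_premeasure s delta A.
Proof.
apply: le_ereal_inf_tmp => _ [U _ <-].
by apply: nneseries_ge0 => k _ _; exact: poweR_ge0.
Qed.

Lemma hausdorff_measure_null A (s : R) (g : R[i]%C) : (0 < s)%R ->
  (forall e d : R, (0 < e)%R -> (0 < d)%R -> exists n N, [/\ disc_covered g A n N,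
    (N%:R * (26 / 10 * normc g ^+ n) `^ s < e)%R & (26 / 10 * normc g ^+ n <= d)%R]) ->
  hausdorff_measure s A = 0.
Proof.
move=> s0 h; apply/eqP; rewrite eq_le; apply/andP; split; last first.
  apply: le_trans (premeasure_ge0 A s 1) _.
  by apply: ereal_sup_ubound; exists 1%R => //=; exact: ltr01.
apply: ge_ereal_sup => _ [d /= d0 <-]; apply/lee_addgt0Pr => e e0; rewrite add0e.
have [n [N [[c cN cA] Ne nd]]] := h e d e0 d0.
have r0 : (0 <= 13 / 10 * normc g ^+ n)%R by rewrite mulr_ge0 ?exprn_ge0 ?normc_ge0.
have r2 : (2 * (13 / 10 * normc g ^+ n) = 26 / 10 * normc g ^+ n)%R by field.
apply: (@le_trans _ _ ((size c)%:R * (2 * (13 / 10 * normc g ^+ n)) `^ s)%:E).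
  by apply: premeasure_covered cA => //; rewrite r2.
rewrite lee_fin; apply: le_trans (ltW Ne); rewrite r2.
by rewrite ler_wpM2r ?powR_ge0 // ler_nat.
Qed.

End HausdorffUpper.

Section BoundaryUpper.
Context {R : realType} {al : R} {g : R[i]%C}.
Hypothesis tp : tent_pair al g.
Context {F : set (plane R)}.
Hypothesis FE : tent_set g F.
Hypothesis cF : compact F.
Hypothesis F0 : F !=set0.
Context {mu : R}.
Hypothesis mu1 : 1 < mu.
Hypothesis mu7 : mu ^+ 7 = 2 * mu ^+ 2 + 1.

Lemma ln_conj_normc : ln (normc g) = - (ln al / 2).
Proof.
have h0 := conj_normc_gt0 tp; have a0 := alpha_gt0 tp.
have : ln (normc g ^+ 2) = - ln al by rewrite (conj_normc_sqr tp) -(alphaV tp) lnV ?posrE.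
by rewrite lnXn // mulr2n => h; lra.
Qed.

Lemma ln_alpha_gt0 : 0 < ln al.
Proof. by rewrite ln_gt0 // (alpha_gt1 tp). Qed.

Lemma conj_powR (s : R) : normc g `^ s = expR (- (s * ln al / 2)).
Proof.
rewrite /powR gt_eqF ?(conj_normc_gt0 tp) // ln_conj_normc.
by congr expR; field.
Qed.

Lemma hausdorff_dim_boundary_le :
  (hausdorff_dim (boundary F) <= (2 * ln mu / ln al)%:E)%E.
Proof.
have la := ln_alpha_gt0; have lm : 0 < ln mu by rewrite ln_gt0.
apply/lee_addgt0Pr => e e0; rewrite -EFinD.
set s := 2 * ln mu / ln al + e.
have s0 : 0 < s by rewrite addr_gt0 // divr_gt0 // mulr_gt0.
apply: ereal_inf_lbound; exists s => //; split=> //.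
have [K covK] := covered_boundary tp FE cF F0.
apply: (@hausdorff_measure_null _ _ _ g) => // eps d eps0 d0.
have /andP[g0 g1] := conj_normc_bounds tp.
(* The covering sum at level n is at most a constant times [q^n]. At the exponent [2 ln mu / ln al]
   this ratio would be 1; the excess [e] makes it [exp (- e ln al / 2)]. *)
pose q := mu * normc g `^ s.
have q01 : 0 <= q < 1.
  apply/andP; split.
    by rewrite /q mulr_ge0 ?powR_ge0 // ltW // (lt_trans ltr01 mu1).
  have mu0 := lt_trans ltr01 mu1.
  rewrite /q conj_powR -{1}[mu]lnK ?posrE // -expRD expR_lt1.
  rewrite (_ : _ - _ = - (e * ln al / 2)); last by rewrite /s; field; rewrite gt_eqF.
  by rewrite oppr_lt0 divr_gt0 // mulr_gt0.
pose C := (K * 11)%:R * 256 * (26 / 10) `^ s.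
have C0 : 0 <= C by rewrite !mulr_ge0 ?powR_ge0.
have [n1 qn] : exists n, q ^+ n < eps / (1 + C).
  by apply: expr_lt_eps => //; rewrite divr_gt0 //; lra.
have [n2 gn] : exists n, normc g ^+ n < d / 3.
  by apply: expr_lt_eps; [lra | rewrite divr_gt0].
(* The level [n1] makes the covering sum small, and [n2] makes the discs smaller than the mesh
   [d]. *)
exists (n1 + n2)%N, (K * (11 * leaf_count (n1 + n2)))%N; split; first exact: covK.
  have h0 : 0 <= normc g by lra.
  rewrite powRM ?exprn_ge0 //.
  rewrite -powR_mulrn // -powRrM [_ * s]mulrC powRrM powR_mulrn ?powR_ge0 //.
  have lc := @leaf_count_le R mu (n1 + n2) (ltW mu1) ltac:(by rewrite mu7).
  apply: (@le_lt_trans _ _ (C * q ^+ (n1 + n2))).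
    rewrite mulnA natrM /C /q exprMn.
    set x := (26 / 10) `^ s; set y := (normc g `^ s) ^+ _.
    have xy : 0 <= x * y by rewrite mulr_ge0 ?exprn_ge0 ?powR_ge0.
    rewrite (_ : (K * 11)%:R * 256 * x * (mu ^+ (n1 + n2) * y) =
      (K * 11)%:R * (256 * mu ^+ (n1 + n2)) * (x * y)); last by ring.
    by rewrite ler_wpM2r // ler_wpM2l.
  apply: (@le_lt_trans _ _ (C * q ^+ n1)).
    rewrite ler_wpM2l // exprD ler_piMr ?exprn_ge0 ?exprn_ile1 //; lra.
  move: qn; rewrite ltr_pdivlMr ?mulrDr ?mulr1; last by lra.
  have : 0 <= q ^+ n1 by rewrite exprn_ge0 //; lra.
  by rewrite [C * _]mulrC; lra.
have : normc g ^+ (n1 + n2) <= normc g ^+ n2.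
  by apply: (conj_normcX_le tp); exact: leq_addl.
lra.
Qed.

End BoundaryUpper.

(** * Words and the lower bound *)

(* [Some false], [Some true] and [None] stand for the maps LRL, RLL and RRL, which are
   x |-> (-1)^[lneg] g^[llen] x + [lcst]. *)
Definition letter := option bool.
Definition letters : seq letter := [:: Some false; Some true; None].
Definition llen (c : letter) : nat := if c is Some _ then 5 else 7.
Definition lneg (c : letter) : bool := if c is Some _ then true else false.
Local Open Scope Z_scope.
(** These are [g^4], [g^3] and [g^3 - g^6] in the basis 1, g, g^2. *)
Definition lcst (c : letter) : ztriple :=
  match c with
  | Some false => (1, 1, 1)
  | Some true => (1, 0, 1)
  | None => (-1, -1, -2)
  end.
Local Close Scope Z_scope.


Definition lmap (R : realType) (g : R[i]%C) (c : letter) (x : R[i]%C) : R[i]%C :=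
  (-1) ^+ lneg c * g ^+ llen c * x + zeval g (lcst c).
Definition wmap (R : realType) (g : R[i]%C) (w : seq letter) (x : R[i]%C) : R[i]%C :=
  foldr (lmap g) x w.
Definition wlen (w : seq letter) : nat := foldr (fun c n => llen c + n)%N 0%N w.
Definition wneg (w : seq letter) : bool := foldr (fun c b => lneg c (+) b) false w.
Definition wcst (w : seq letter) : ztriple :=
  foldr (fun c z => zsub (lcst c) (zsign (~~ lneg c) (iter (llen c) zmulg z)))
        (Z0, Z0, Z0) w.

Lemma wmapE (R : realType) (g : R[i]%C) (w : seq letter) (x : R[i]%C) :
  g ^+ 3 = g ^+ 2 + 1 ->
  wmap g w x = (-1) ^+ wneg w * g ^+ wlen w * x + zeval g (wcst w).
Proof.
move=> g3; elim: w => [|c w IHw].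
  by rewrite /= /zeval /= !zrE !rmorph0 !mul0r !addr0 expr0 !mul1r.
rewrite /= IHw /lmap zval_sub zval_sign (zval_iter_mulg g3) signr_addb exprD signrN.
by move: (zeval _ _) (zeval _ _) (_ ^+ lneg c) (_ ^+ wneg w) => a b p q; ring.
Qed.

(* Words stopped as soon as their weight [wlen] reaches [n]; the fuel [l] suffices
   when [n <= l]. *)
Fixpoint stop_words (l n : nat) : seq (seq letter) :=
  if n is 0 then [:: [::]]
  else if l is l'.+1 then
    [seq c :: w | c <- letters, w <- stop_words l' (n - llen c)]
  else [::].

Lemma llen_gt0 c : (0 < llen c)%N. Proof. by case: c. Qed.

Lemma stop_words_uniq l n : uniq (stop_words l n).
Proof.
elim: l n => [|l IHl] [|n] //.
rewrite [stop_words _ _]/(allpairs_dep _ _ _); apply: allpairs_uniq_dep => //.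
by move=> [c w] [c' w'] _ _ /= [-> ->].
Qed.

Lemma stop_words_wlen l n w : w \in stop_words l n ->
  (n <= wlen w < n + (if n == 0 then 1 else 7))%N.
Proof.
elim: l n w => [|l IHl] [|n] w //; rewrite ?inE; do ?by move/eqP ->.
move=> /allpairsPdep[c [v [_ /IHl vn ->]]]; move: vn; rewrite /=.
by case: eqP; case: c => [b|] /=; lia.
Qed.

(** * Words acting on the real line *)

Section RealConjugate.
Context {R : realType} {al : R}.
Hypothesis a3 : al ^+ 3 = al ^+ 2 + 1.

(** Taken as a complex number so that [zeval], [lmap] and [wmap] apply to both conjugates. *)
Let A : R[i]%C := al%:C%C.

Let A3 : A ^+ 3 = A ^+ 2 + 1.
Proof. by rewrite -!rmorphXn a3 rmorphD rmorph1. Qed.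

(* Over the reals the inverse branch of each letter maps ]0, 1[ into its band, and
   the bands are disjoint. *)
Definition lband (c : letter) : R * R :=
  match c with
  | Some false => (al^-1 - al^-1 ^+ 5, al^-1)
  | Some true => (al^-1 ^+ 2 - al^-1 ^+ 5, al^-1 ^+ 2)
  | None => (al^-1 ^+ 2, al^-1 - al^-1 ^+ 5)
  end.

Lemma alpha_powers :
  [/\ al ^+ 4 = al ^+ 2 + al + 1, al ^+ 5 = 2 * al ^+ 2 + al + 1 &
      al ^+ 7 = 4 * al ^+ 2 + 2 * al + 3].
Proof.
have a4 : al ^+ 4 = al ^+ 2 + al + 1.
  by rewrite exprS a3 mulrDr mulr1 -exprS a3; ring.
have a5 : al ^+ 5 = 2 * al ^+ 2 + al + 1.
  by rewrite exprS a4 !mulrDr mulr1 -exprS a3 -expr2; ring.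
split=> //; transitivity (al ^+ 2 * al ^+ 5); first by rewrite -exprD.
rewrite a5 !mulrDr mulrCA -exprD a4 -exprSr a3 mulr1; ring.
Qed.
Lemma lmap_real c (y : R) : lmap A c y%:C%C =
  ((-1) ^+ lneg c * al ^+ llen c * y + (match c with Some false => al ^+ 4
     | Some true => al ^+ 3 | None => al ^+ 3 - al ^+ 6 end))%:C%C.
Proof.
have [a4 a5 a7] := alpha_powers.
have a6 : al ^+ 6 = 3 * al ^+ 2 + al + 2.
  by rewrite exprS a5 !mulrDr mulr1 mulrCA -exprS a3 -expr2; ring.
rewrite /lmap /zeval /A; case: c => [[]|] /=; rewrite !zrE ?a3 ?a4 ?a6.
all: by rewrite ?rmorph0 ?rmorph1; ring.
Qed.

(** On the real line a letter expands, so its inverse branch contracts the unit interval into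
    itself. The closed form is used at [t = 0] to bound constants, the strict form at [t = 1/2] to
    tell letters apart. *)
Lemma lmap_real_preimage c (t : R) : 0 <= t <= 1 -> exists y : R,
  [/\ lmap A c y%:C%C = t%:C%C, 0 <= y <= 1 &
      0 < t < 1 -> (lband c).1 < y < (lband c).2].
Proof.
have /andP[a1 a2] := cubic_root_bounds a3.
have a0 : al != 0 by rewrite gt_eqF //; lra.
rewrite /lband; set b := al^-1.
have ab k : al ^+ k * b ^+ k = 1 by rewrite -exprMn mulfV ?expr1n.
have b3 : b ^+ 3 = 1 - b.
  apply: (mulfI (expf_neq0 3 a0)); rewrite ab.
  have -> : al ^+ 3 * (1 - b) = al ^+ 3 - al ^+ 2 * (al ^+ 1 * b ^+ 1) by ring.
  by rewrite ab a3; ring.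
have b5 : b ^+ 5 = b ^+ 2 + b - 1 by rewrite exprSr exprSr b3; ring: b3.
have b7 : b ^+ 7 = 1 - 2 * b ^+ 2.
  by rewrite !exprSr expr0 mul1r; ring: b3.
have b12 : 68 / 100 < b < 685 / 1000.
  have := ab 1%N; rewrite !expr1 => ab1; apply/andP; split; nra.
have ab1 : al * b = 1 by have := ab 1%N; rewrite !expr1.
have b5_gt0 : 0 < b ^+ 5 by rewrite b5; nra.
have b7_gt0 : 0 < b ^+ 7 by rewrite b7; nra.
move=> /andP[t0 t1].
have t5 : 0 <= t * b ^+ 5 <= b ^+ 5 by rewrite mulr_ge0 ?ler_piMl // ltW.
have t7 : 0 <= t * b ^+ 7 <= b ^+ 7 by rewrite mulr_ge0 ?ler_piMl // ltW.
have strict (s : R) : 0 < s -> 0 < t < 1 -> 0 < t * s < s.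
  by move=> s0 /andP[t0' t1']; rewrite mulr_gt0 // gtr_pMl.
have b2 : b ^+ 2 < b by nra.
case: c => [[]|] /=.
- exists (b ^+ 2 - t * b ^+ 5); split; [|by move: t5; rewrite b5; lra|].
    rewrite lmap_real /=; congr (_%:C)%C.
    transitivity (t * (al ^+ 5 * b ^+ 5) - al ^+ 3 * (al ^+ 2 * b ^+ 2 - 1)); first by ring.
    by rewrite !ab; ring.
  by move=> /(strict _ b5_gt0); lra.
- exists (b - t * b ^+ 5); split; [|by move: t5; rewrite b5; lra|].
    rewrite lmap_real /=; congr (_%:C)%C.
    transitivity (t * (al ^+ 5 * b ^+ 5) - al ^+ 4 * (al ^+ 1 * b ^+ 1 - 1)); first by ring.
    by rewrite !ab; ring.
  by move=> /(strict _ b5_gt0); lra.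
- exists (b ^+ 2 + t * b ^+ 7); split; [|by move: t7; rewrite b7; lra|].
    rewrite lmap_real /=; congr (_%:C)%C.
    transitivity (t * (al ^+ 7 * b ^+ 7) + al ^+ 5 * (al ^+ 2 * b ^+ 2 - 1)
                  - al ^+ 3 * (al ^+ 3 - (al ^+ 2 + 1))); first by ring.
    by rewrite !ab a3; ring.
  by move=> /(strict _ b7_gt0); rewrite b5 b7; lra.
Qed.

(** With [b = 1 / al], the points b^2 - b^5 < b^2 < b - b^5 < b delimit three adjacent bands, those
    of RLL, RRL and LRL in this order. *)
Lemma lband_order :
  [/\ 0 < al^-1 ^+ 2 - al^-1 ^+ 5, al^-1 ^+ 2 < al^-1 - al^-1 ^+ 5,
      al^-1 ^+ 2 - al^-1 ^+ 5 < al^-1 ^+ 2, al^-1 - al^-1 ^+ 5 < al^-1 & al^-1 < 1].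
Proof.
have /andP[a1 a2] := cubic_root_bounds a3.
have ab1 : al * al^-1 = 1 by rewrite mulfV // gt_eqF //; lra.
have b12 : 68 / 100 < al^-1 < 685 / 1000 by apply/andP; split; nra.
have b3 : al^-1 ^+ 3 = 1 - al^-1.
  have : al ^+ 3 * (al^-1 ^+ 3 - (1 - al^-1)) = 0.
    transitivity ((al * al^-1) ^+ 3 - al ^+ 3 + al ^+ 2 * (al * al^-1)); first by ring.
    by rewrite ab1 a3; ring.
  by move/eqP; rewrite mulf_eq0 expf_eq0 /= gt_eqF ?subr_eq0 => [/eqP//|]; lra.
have b5 : al^-1 ^+ 5 = al^-1 ^+ 2 + al^-1 - 1 by ring: b3.
by rewrite b5; split; nra.
Qed.

Lemma lband_disjoint c d y : (lband c).1 < y < (lband c).2 ->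
  (lband d).1 < y < (lband d).2 -> c = d.
Proof.
have [h1 h2 h3 h4 h5] := lband_order.
by case: c => [[]|]; case: d => [[]|] //= y1 y2; exfalso; move: h1 h2 h3 h4 h5 y1 y2;
  move: (al^-1 ^+ 2) (al^-1 ^+ 5) (al^-1) => p q r; lra.
Qed.

Lemma lband_in01 c y : (lband c).1 < y < (lband c).2 -> 0 < y < 1.
Proof.
have [h1 h2 h3 h4 h5] := lband_order.
by case: c => [[]|] /= y1; move: h1 h2 h3 h4 h5 y1;
  move: (al^-1 ^+ 2) (al^-1 ^+ 5) (al^-1) => p q r; lra.
Qed.

Lemma wmap_real_preimage w (t : R) : 0 <= t <= 1 ->
  exists y : R, [/\ wmap A w y%:C%C = t%:C%C, 0 <= y <= 1 & 0 < t < 1 -> 0 < y < 1].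
Proof.
elim: w t => [|c w IHw] t t01; first by exists t.
have [y [yt y01 yb]] := lmap_real_preimage c t01.
have [z [zy z01 zb]] := IHw y y01; exists z; split=> //=; first by rewrite zy.
by move=> /yb/lband_in01.
Qed.

Lemma wmap_real_half w c : exists y : R,
  (lband c).1 < y < (lband c).2 /\ wmap A (rcons w c) y%:C%C = (1 / 2)%:C%C.
Proof.
have [|y [yt y01 yb]] := @wmap_real_preimage w (1 / 2); first by lra.
have [z [zy z01 zb]] := lmap_real_preimage c y01.
exists z; split; first by apply/zb/yb; lra.
by rewrite /wmap foldr_rcons /= zy.
Qed.

Lemma wlen_rcons w c : wlen (rcons w c) = (wlen w + llen c)%N.
Proof. by elim: w => [|d w IHw] /=; [rewrite addn0 | rewrite IHw addnA]. Qed.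

(** The last letter is the innermost map, so the preimage of 1/2 lies in its band. Equal maps have
    the same preimage, hence the same last letter, which is then cancelled by evaluating at its
    preimage of an arbitrary point. *)
Lemma wmap_inj w v : wlen w = wlen v -> (forall x, wmap A w x = wmap A v x) -> w = v.
Proof.
have A0 : A != 0.
  have /andP[a1 _] := cubic_root_bounds a3; apply/eqP => /complexI a0; move: a1.
  by rewrite a0; lra.
have slope0 (e : bool) k : (-1) ^+ e * A ^+ k != 0 by rewrite mulf_neq0 ?signr_eq0 ?expf_neq0.
elim/last_ind: w v => [|w c IHw] v; case/lastP: v => [|v d] //.
- move=> h _; exfalso; move: h (llen_gt0 d); rewrite wlen_rcons /=.
  by move: (llen d) (wlen v) => p q; lia.
- move=> h _; exfalso; move: h (llen_gt0 c); rewrite wlen_rcons /=.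
  by move: (llen c) (wlen w) => p q; lia.
move=> wv h; have [y [yc yh]] := wmap_real_half w c; have [z [zd zh]] := wmap_real_half v d.
have yz : y = z.
  move: yh; rewrite h -zh !(wmapE _ _ A3) => /addIr /(mulfI (slope0 _ _)).
  exact: complexI.
have cd : c = d by apply: lband_disjoint yc _; rewrite yz.
rewrite cd in wv h *; congr (rcons _ _); apply: IHw.
  by move: wv; rewrite !wlen_rcons => /addIn.
move=> x; have := h ((x - zeval A (lcst d)) / ((-1) ^+ lneg d * A ^+ llen d)).
rewrite /wmap !foldr_rcons /lmap mulrCA mulfV ?slope0 // mulr1 subrK.
exact.
Qed.

Lemma normc_real (x : R) : normc x%:C%C = `|x|.
Proof. by rewrite /= expr0n addr0 sqrtr_sqr. Qed.

(** The constant is, up to sign, [al^(wlen w)] times the preimage of 0, which lies in the unit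
    interval. *)
Lemma wcst_real_bound w : normc (zeval A (wcst w)) <= al ^+ wlen w.
Proof.
have [|y [y0 y01 _]] := @wmap_real_preimage w 0; first by rewrite lexx ler01.
have /andP[a1 _] := cubic_root_bounds a3.
move: y0; rewrite (wmapE _ _ A3) rmorph0 => /eqP; rewrite addrC addr_eq0 => /eqP ->.
rewrite normcN !normcM normcX !normc_real sign_normc mul1r.
rewrite !ger0_norm ?ler_piMr ?exprn_ge0 //; lra.
Qed.

End RealConjugate.

(** * Counting the cylinders near a point *)

Section WordCount.
Context {R : realType} {al : R} {g : R[i]%C}.
Hypothesis tp : tent_pair al g.

Let a3 : al ^+ 3 = al ^+ 2 + 1. Proof. by have [] := tp. Qed.
Let g3 : g ^+ 3 = g ^+ 2 + 1. Proof. by have [] := tp. Qed.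
Let A : R[i]%C := al%:C%C.
Let A3 : A ^+ 3 = A ^+ 2 + 1.
Proof. by rewrite -!rmorphXn a3 rmorphD rmorph1. Qed.

(** Z[g] is discrete under the pair of its complex and real embeddings, so bounds in both leave
    finitely many coordinates. *)
Lemma zeval_bounded (D D' : R) z : normc (zeval g z) <= D -> normc (zeval A z) <= D' ->
  [/\ `|zr z.1.1| <= 3 * (D + D') :> R, `|zr z.1.2| <= 3 * (D + D') :> R &
      `|zr z.2| <= 3 * (D + D') :> R].
Proof.
move=> gD aD; have ab := alpha_bounds tp.
have Reg := Re_conj tp; have Img := Im_conj_sqr tp; have gs := conj_sqr tp.
have g2 : normc (zeval g z) ^+ 2 <= D ^+ 2.
  by rewrite ler_sqr ?nnegrE ?normc_ge0 // (le_trans _ gD) ?normc_ge0.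
have D0 : 0 <= D by apply: le_trans gD; exact: normc_ge0.
case: z g2 aD {gD} => -[a b] c.
have -> : zeval A (a, b, c) = (zr a + zr b * al + zr c * al ^+ 2)%:C%C.
  by rewrite /zeval /= /A; ring.
have -> : zeval g (a, b, c) = (zr a - zr c * (al ^+ 2 - al))%:C%C
    + (zr b + (1 - al) * zr c)%:C%C * g by rewrite /zeval gs; ring.
rewrite [(_, _, _).1.1]/= [(_, _, _).1.2]/= [(_, _, _).2]/=.
move: (zr a) (zr b) (zr c) => {}a {}b {}c.
rewrite normc_real normc_sqr.
pose X := b + (1 - al) * c; pose Y := a - c * (al ^+ 2 - al); rewrite -/X -/Y.
move: Reg Img; case: (g) => x y /= ex ey h aD.
have {}h : (Y + X * x) ^+ 2 + X ^+ 2 * y ^+ 2 <= D ^+ 2.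
  suff -> : (Y + X * x) ^+ 2 + X ^+ 2 * y ^+ 2 =
     (Y + (X * x - 0 * y)) ^+ 2 + (0 + (X * y + 0 * x)) ^+ 2 by [].
  by ring.
have y1 : 61 / 100 <= y ^+ 2 by rewrite ey; nra.
have h1 : `|Y + X * x| <= D.
  rewrite -ler_sqr ?nnegrE // real_normK ?num_real //; apply: le_trans h.
  by rewrite lerDl mulr_ge0 ?sqr_ge0.
have h2 : `|X| <= 129 / 100 * D.
  rewrite -ler_sqr ?nnegrE //; last by lra.
  rewrite real_normK ?num_real //.
  have := sqr_ge0 (Y + X * x); have := sqr_ge0 X; nra.
(* Division by the quadratic factor of [g] leaves the remainder [Y + X t]. At [t = al] that factor
   equals [3 al^2 - 2 al], the derivative of the cubic there. *)
have cE : c * (3 * al ^+ 2 - 2 * al) = (a + b * al + c * al ^+ 2) - Y - al * X.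
  by rewrite /X /Y; ring.
have bE : b = X - (1 - al) * c by rewrite /X; ring.
have aE : a = Y + c * (al ^+ 2 - al) by rewrite /Y; ring.
clearbody X Y; move: aD cE; move: (a + b * al + c * al ^+ 2) => Z aD cE.
have h3 : `|X * x| <= 129 / 100 * D * (24 / 100).
  by rewrite normrM ler_pM // ler_norml; lra.
have h4 : `|al * X| <= 147 / 100 * (129 / 100 * D).
  by rewrite normrM ler_pM // ler_norml; lra.
have s1 : 3 <= 3 * al ^+ 2 - 2 * al by nra.
have h5 : 3 * `|c| <= D' + 3311 / 1000 * D.
  apply: (@le_trans _ _ `|c * (3 * al ^+ 2 - 2 * al)|).
    by rewrite normrM mulrC ler_wpM2l // (le_trans s1) // ler_norm.
  move: h1 h3 h4 aD; rewrite cE !ler_norml; lra.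
have D'0 : 0 <= D' by apply: le_trans aD; exact: normr_ge0.
have c0 := normr_ge0 c.
have h6 : `|(1 - al) * c| <= 47 / 100 * `|c|.
  by rewrite normrM ler_wpM2r // ler_norml; lra.
have h7 : `|c * (al ^+ 2 - al)| <= `|c| * (7 / 10).
  by rewrite normrM ler_wpM2l // ler_norml; apply/andP; split; nra.
split; last by lra.
  by rewrite aE; move: h1 h3 h7 h5; rewrite !ler_norml; lra.
by rewrite bE; move: h2 h6 h5; rewrite !ler_norml; lra.
Qed.

Lemma zeval_iter_divg_norm (h : R[i]%C) n z : h ^+ 3 = h ^+ 2 + 1 -> h != 0 ->
  normc (zeval h (iter n zdivg z)) = normc (zeval h z) / normc h ^+ n.
Proof.
move=> h3 h0; rewrite -(zval_iter_divg h3 n z) normcM normcX.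
by rewrite mulrC mulKf // expf_neq0 //; apply: contra h0 => /eqP/eq0_normc ->.
Qed.

Definition zcube (B : nat) : seq ztriple :=
  let s := [seq Z.sub (Z.of_nat k) (Z.of_nat B) | k <- iota 0 (B + B).+1] in
  [seq (p, c) | p <- [seq (a, b) | a <- s, b <- s], c <- s].

Lemma mem_zcube B z : `|zr z.1.1| <= B%:R :> R -> `|zr z.1.2| <= B%:R :> R ->
  `|zr z.2| <= B%:R :> R -> z \in zcube B.
Proof.
have mem (a : Z) : `|zr a| <= B%:R :> R ->
    a \in [seq Z.sub (Z.of_nat k) (Z.of_nat B) | k <- iota 0 (B + B).+1].
  rewrite /zr ler_norml => /andP[].
  rewrite -[B%:R : R]/((Posz B)%:~R) -intrN !ler_int => a1 a2; apply/mapP.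
  by exists (Z.to_nat (Z.add a (Z.of_nat B))); [rewrite mem_iota; lia | lia].
case: z => -[a b] c /= /mem aB /mem bB /mem cB.
apply/allpairsP; exists ((a, b), c); split=> //.
by apply/allpairsP; exists (a, b).
Qed.

Lemma iter_zdivg_inj n : injective (iter n zdivg).
Proof.
have dinj : injective zdivg by exact: (can_inj zmulgK).
by elim: n => [|n IHn] z w //= /dinj/IHn.
Qed.

Lemma zsub_inj z : injective (zsub^~ z).
Proof. by case: z => -[a b] c [[a1 b1] c1] [[a2 b2] c2] /= [] *; congr (_, _, _); lia. Qed.

Lemma words_near_bounded : exists K : nat, forall n (p : R[i]%C) (L : seq (seq letter)),
  uniq L -> {in L, forall w, (n <= wlen w < n + 7)%N /\
    exists2 x, normc x <= 13 / 10 & normc (p - wmap g w x) <= normc g ^+ n} ->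
  (size L <= K)%N.
Proof.
have g0 := conj_neq0 tp; have /andP[n0 n1] := conj_normc_bounds tp.
have /andP[a1 a2] := alpha_bounds tp.
have A0 : A != 0 by apply/eqP => /complexI a0; move: a1; rewrite a0; lra.
pose B := Num.bound (3 * (46 / 10 + 40) : R).
pose T := [seq (p, z) | p <- [seq (k, e) | k <- iota 0 7, e <- [:: false; true]],
                        z <- zcube B].
exists (size T) => n p [|w0 L] // Lu Lnear.
pose z w := iter n zdivg (wcst w).
have zg w : w \in w0 :: L -> normc (zeval g (z w) - p / g ^+ n) <= 23 / 10.
  move=> /Lnear[/andP[wn _] [x x1 px]].
  have gn : 0 < normc g ^+ n by rewrite exprn_gt0 //; lra.
  have zE : g ^+ n * (zeval g (z w) - p / g ^+ n) =
      - (p - wmap g w x) - (-1) ^+ wneg w * g ^+ wlen w * x.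
    rewrite mulrBr (zval_iter_divg g3) mulrCA mulfV ?expf_neq0 // mulr1.
    by rewrite (wmapE _ _ g3); ring.
  rewrite -(ler_pM2l gn) -normcX -normcM zE; apply: le_trans (le_normcD _ _) _.
  rewrite !normcN !normcM sign_normc mul1r !normcX.
  have : normc g ^+ wlen w <= normc g ^+ n by apply: (conj_normcX_le tp).
  have := normc_ge0 x; nra.
(* The length exceeds [n] by less than 7, and [al^7 < 20]. *)
have zA w : w \in w0 :: L -> normc (zeval A (z w)) <= 20.
  move=> /Lnear[/andP[wn1 wn] _]; rewrite zeval_iter_divg_norm // normc_real ger0_norm; last by lra.
  rewrite ler_pdivrMr ?exprn_gt0 //; last by lra.
  apply: le_trans (wcst_real_bound a3 w) _.
  apply: (@le_trans _ _ (al ^+ (7 + n))); first by apply: ler_weXn2l; [lra | lia].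
  rewrite exprD ler_wpM2r ?exprn_ge0 //; first by lra.
  have [_ _ ->] := alpha_powers a3; nra.
(* The position [p / g^n] is arbitrary, so only differences of the normalised constants are bounded;
   [w0] serves as reference. The bounds 46/10 and 40 are twice 23/10 and 20. *)
pose f w := ((wlen w - n, wneg w)%N, zsub (z w) (z w0)).
have -> : size (w0 :: L) = size [seq f w | w <- w0 :: L] by rewrite size_map.
apply: uniq_leq_size.
  rewrite map_inj_in_uniq // => w v wL vL [] wv nv /zsub_inj/iter_zdivg_inj cv.
  have [/andP[wn _] _] := Lnear w wL; have [/andP[vn _] _] := Lnear v vL.
  have lv : wlen w = wlen v by move: wn vn wv; clear; lia.
  by apply: (wmap_inj a3) => // x; rewrite !(wmapE _ _ A3) lv nv cv.
move=> _ /mapP[w wL ->]; apply/allpairsP; exists ((wlen w - n, wneg w)%N, zsub (z w) (z w0)).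
split=> //.
  apply/allpairsP; exists (wlen w - n, wneg w)%N; split=> //.
    have [/andP[wn wn7] _] := Lnear w wL; rewrite mem_iota.
    by move: wn wn7; rewrite /=; clear; lia.
  by case: (wneg w).
have w0L : w0 \in w0 :: L by rewrite mem_head.
have [] := @zeval_bounded (46 / 10) 40 (zsub (z w) (z w0)).
- rewrite zval_sub (_ : _ - _ = (zeval g (z w) - p / g ^+ n) + - (zeval g (z w0) - p / g ^+ n)).
    apply: le_trans (le_normcD _ _) _; rewrite normcN.
    by have := zg w wL; have := zg w0 w0L; lra.
  by ring.
- rewrite zval_sub; apply: le_trans (le_normcD _ _) _; rewrite normcN.
  by have := zA w wL; have := zA w0 w0L; lra.
have Bb : 3 * (46 / 10 + 40) <= B%:R :> R by apply: ltW; apply: archi_boundP; lra.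
by move=> h1 h2 h3; apply: mem_zcube; [exact: le_trans h1 Bb | exact: le_trans h2 Bb
  | exact: le_trans h3 Bb].
Qed.

End WordCount.

(* Mass given to [B] by the words of length [l], each having weight [theta ^ wlen]
   placed at the image of [x0]. *)
Fixpoint word_mass (R : realType) (g : R[i]%C) (theta : R) (x0 : R[i]%C)
    (l : nat) (B : R[i]%C -> Prop) : R :=
  if l is l'.+1 then
    \sum_(c <- letters) theta ^+ llen c * word_mass g theta x0 l' (fun x => B (lmap g c x))
  else (`[< B x0 >])%:R.

Lemma asbool_le (R : realType) (P Q : Prop) :
  (P -> Q) -> (`[< P >])%:R <= (`[< Q >])%:R :> R.
Proof. by case: asboolP => p; case: asboolP => q //= pq; have := pq p. Qed.

(** * Mass distribution on F ∩ (1 - F) *)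

Section MassDistribution.
Context {R : realType} {al : R} {g : R[i]%C}.
Hypothesis tp : tent_pair al g.
Context {F : set (plane R)}.
Hypothesis FE : tent_set g F.
Hypothesis cF : compact F.
Hypothesis F0 : F !=set0.
Context {mu : R}.
Hypothesis mu1 : 1 < mu.
Hypothesis mu7 : mu ^+ 7 = 2 * mu ^+ 2 + 1.

Let g3 : g ^+ 3 = g ^+ 2 + 1. Proof. by have [] := tp. Qed.
Let theta := mu^-1.
Let x0 : R[i]%C := (1 / 2 : R)%:C%C.

Definition core (x : R[i]%C) : Prop := F x /\ F (1 - x).

Lemma tile_lmap c x : F x -> F (lmap g c x).
Proof.
have L y : F y -> F (g * y) by move=> Fy; apply/FE; left; exists y.
have Rr y : F y -> F (g ^+ 3 * (1 - y)) by move=> Fy; apply/FE; right; exists y.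
move=> Fx; case: c => [[]|].
- rewrite (_ : lmap _ _ _ = g ^+ 3 * (1 - g * (g * x))); first by apply/Rr/L/L.
  by rewrite /lmap /zeval /= !zrE; ring: g3.
- rewrite (_ : lmap _ _ _ = g * (g ^+ 3 * (1 - g * x))); first by apply/L/Rr/L.
  by rewrite /lmap /zeval /= !zrE; ring: g3.
- rewrite (_ : lmap _ _ _ = g ^+ 3 * (1 - g ^+ 3 * (1 - g * x))); first by apply/Rr/Rr/L.
  by rewrite /lmap /zeval /= !zrE; ring: g3.
Qed.

(** Reflection exchanges LRL with RLL and fixes RRL; this is why the three maps preserve F ∩ (1 -
    F). *)
Lemma lmap_reflect c x :
  1 - lmap g c x = lmap g (if c is Some b then Some (~~ b) else None) (1 - x).
Proof.
by rewrite /lmap /zeval; case: c => [[]|] /=; rewrite !zrE; ring: g3.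
Qed.

Lemma core_lmap c x : core x -> core (lmap g c x).
Proof. by move=> [Fx Fx']; split; rewrite ?lmap_reflect; exact: tile_lmap. Qed.

(** By the symmetry of RRL its fixed point is 1/2; iterating RRL from any point of F converges to
    it, and F is closed. *)
Lemma core_half : core x0.
Proof.
have half : 1 - x0 = x0.
  by rewrite /x0 -[1](rmorph1 (real_complex R)) -rmorphB; congr (_%:C)%C; field.
suff Fh : F x0 by split; rewrite ?half.
have fixed : lmap g None x0 = x0.
  have := lmap_reflect None x0; rewrite half => /eqP; rewrite subr_eq -mulr2n -mulr_natl => /eqP e.
  have two : (2 : R[i]%C) != 0 by rewrite pnatr_eq0.
  apply: (mulfI two); rewrite -e /x0 -[2]/(2%:R) -(rmorph_nat (real_complex R)) -rmorphM.
  by rewrite -[LHS](rmorph1 (real_complex R)); congr (_%:C)%C; field.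
apply: contrapT => nF.
have [r r0 rF] := closed_planeP (compact_plane_closed cF) nF.
have [y Fy] := F0; have /andP[n0 n1] := conj_normc_bounds tp.
have Fn n : exists2 z, F z & normc (x0 - z) = normc g ^+ (7 * n) * normc (x0 - y).
  elim: n => [|n [z Fz zn]]; first by exists y; rewrite // muln0 expr0 mul1r.
  exists (lmap g None z); first exact: tile_lmap.
  rewrite -{1}fixed /lmap (_ : _ - _ = g ^+ 7 * (x0 - z)); last by rewrite /=; ring.
  by rewrite normcM normcX zn mulrA -exprD mulnS.
have m1 : 0 < 1 + normc (x0 - y) by have := normc_ge0 (x0 - y); lra.
have [n gn] : exists n, normc g ^+ n < r / (1 + normc (x0 - y)).
  by apply: expr_lt_eps; [lra | rewrite divr_gt0].
have [z Fz zn] := Fn n; apply: (rF z) => //.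
rewrite zn; move: gn; rewrite ltr_pdivlMr // => gn.
have p7 : normc g ^+ (7 * n) <= normc g ^+ n by apply: (conj_normcX_le tp); lia.
have := ler_wpM2r (normc_ge0 (x0 - y)) p7.
have : 0 < normc g ^+ n by rewrite exprn_gt0 //; lra.
by lra.
Qed.

Lemma theta_sum : \sum_(c <- letters) theta ^+ llen c = 1.
Proof.
have m0 : mu != 0 by rewrite gt_eqF // (lt_trans ltr01).
rewrite /letters !big_cons big_nil /= addr0.
have mt : mu * theta = 1 by rewrite mulfV.
apply: (mulfI (expf_neq0 7 m0)); rewrite mulr1.
transitivity (2 * mu ^+ 2 * (mu * theta) ^+ 5 + (mu * theta) ^+ 7).
  by move: (theta) => t; ring.
by rewrite mt !expr1n mulr1.
Qed.

Local Notation mass := (word_mass g theta x0).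

Let theta_ge0 : 0 <= theta.
Proof. by rewrite invr_ge0 ltW // (lt_trans ltr01). Qed.

Lemma mass_cover l K (B : nat -> R[i]%C -> Prop) :
  (forall x, core x -> exists2 k, (k < K)%N & B k x) ->
  1 <= \sum_(k < K) mass l (B k).
Proof.
elim: l B => [|l IHl] B cB /=.
  have [k kK Bk] := cB x0 core_half.
  by rewrite (bigD1 (Ordinal kK)) //= asboolT // lerDl sumr_ge0.
rewrite exchange_big /= -theta_sum; apply: ler_sum => c _.
rewrite -mulr_sumr ler_peMr ?exprn_ge0 //; apply: (IHl (fun k x => B k (lmap g c x))).
by move=> x /(core_lmap c) /cB.
Qed.

Lemma mass_le_hit l (B : R[i]%C -> Prop) :
  mass l B <= (`[< exists2 x, F x & B x >])%:R.
Proof.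
elim: l B => [|l IHl] B /=.
  by apply: asbool_le => Bx; exists x0 => //; have [] := core_half.
pose h : R := (`[< exists2 x, F x & B x >])%:R; rewrite -/h.
have -> : h = \sum_(c <- letters) theta ^+ llen c * h.
  by rewrite -mulr_suml theta_sum mul1r.
apply: ler_sum => c _; rewrite ler_wpM2l ?exprn_ge0 //; apply: le_trans (IHl _) _.
apply: asbool_le => -[x Fx Bx].
by exists (lmap g c x) => //; exact: tile_lmap.
Qed.

Lemma mass_mono l (B B' : R[i]%C -> Prop) : (forall x, B x -> B' x) -> mass l B <= mass l B'.
Proof.
elim: l B B' => [|l IHl] B B' BB /=.
  by apply: asbool_le => /BB.
by apply: ler_sum => c _; rewrite ler_wpM2l ?exprn_ge0 //; apply: IHl => x /BB.
Qed.

(** Words are cut where their weight reaches [n]; the remaining letters contribute at most 1, and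
    nothing unless [B] meets the corresponding copy of F. *)
Lemma mass_stop l n (B : R[i]%C -> Prop) : (n <= l)%N -> mass l B <=
  \sum_(w <- stop_words l n) theta ^+ wlen w * (`[< exists2 x, F x & B (wmap g w x) >])%:R.
Proof.
elim: l n B => [|l IHl] [|n] B // nl.
- by rewrite big_seq1 expr0 mul1r; exact: (mass_le_hit 0).
- by rewrite big_seq1 expr0 mul1r; exact: mass_le_hit.
rewrite big_allpairs_dep /=; apply: ler_sum => c _.
apply: le_trans (ler_wpM2l (exprn_ge0 _ theta_ge0) (IHl (n.+1 - llen c)%N _ _)) _.
  by have := llen_gt0 c; move: nl; clear; lia.
by rewrite mulr_sumr; apply: ler_sum => w _; rewrite exprD mulrA.
Qed.

Lemma mass_disc : exists K : nat, forall l n p, (n <= l)%N ->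
  mass l (fun x => normc (p - x) <= normc g ^+ n) <= K%:R * theta ^+ n.
Proof.
have [K wK] := words_near_bounded tp.
exists K => l n p nl; apply: le_trans (mass_stop _ nl) _.
pose P w := `[< exists2 x, F x & normc (p - wmap g w x) <= normc g ^+ n >].
rewrite (eq_bigr (fun w => if P w then theta ^+ wlen w else 0)); last first.
  by move=> w _; rewrite /P; case: asboolP => _; rewrite ?mulr1 ?mulr0.
rewrite -big_mkcond /= -big_filter.
have th1 : theta <= 1 by rewrite invf_le1 ?(lt_trans ltr01) // ltW.
apply: (@le_trans _ _ (\sum_(w <- [seq w <- stop_words l n | P w]) theta ^+ n)).
  rewrite big_seq [leRHS]big_seq; apply: ler_sum => w; rewrite mem_filter => /andP[_].
  by move=> /stop_words_wlen/andP[nw _]; apply: ler_wiXn2l.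
rewrite big_const_seq count_predT iter_addr_0 -[theta ^+ n *+ _]mulr_natl ler_wpM2r ?exprn_ge0 //.
rewrite ler_nat; apply: (wK n p); first by rewrite filter_uniq // stop_words_uniq.
move=> w; rewrite mem_filter => /andP[/asboolP[x Fx xB] /stop_words_wlen wn]; split.
  by move: wn; case: eqP; clear; lia.
by exists x => //; exact: (tile_bounded tp FE cF).
Qed.

End MassDistribution.

(** * The mass distribution principle *)

Section BoundaryLower.
Context {R : realType} {al : R} {g : R[i]%C}.
Hypothesis tp : tent_pair al g.
Context {F : set (plane R)}.
Hypothesis FE : tent_set g F.
Hypothesis cF : compact F.
Hypothesis F0 : F !=set0.
Context {mu : R}.
Hypothesis mu1 : 1 < mu.
Hypothesis mu7 : mu ^+ 7 = 2 * mu ^+ 2 + 1.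

Let d := 2 * ln mu / ln al.
Local Notation mass := (word_mass g mu^-1 (1 / 2 : R)%:C%C).

Lemma conj_powR_dim : normc g `^ d = mu^-1.
Proof.
have mu0 := lt_trans ltr01 mu1.
rewrite (conj_powR tp) (_ : d * ln al / 2 = ln mu).
  by rewrite expRN lnK.
by rewrite /d; field; rewrite gt_eqF // (ln_alpha_gt0 tp).
Qed.

Lemma core_compact : compact [set x : plane R | core (F := F) x].
Proof.
have -> : [set x : plane R | core (F := F) x] =
    F `&` [set x | in_tile g F true 0 0 x].
  apply/seteqP; split=> x /= [Fx h]; split=> //.
    by exists (1 - x) => //; rewrite /shift /= !mulr0z !mul0r !addr0 expr1; ring.
  have [y Fy ->] := h; rewrite /shift /= !mulr0z !mul0r !addr0 expr1.
  by rewrite (_ : _ - _ = y) //; ring.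
have cl : closed (in_tile g F true 0 0 : set (plane R)) by exact: tile_closed.
exact: compact_closedI cF cl.
Qed.

Lemma scale_exists (r : R) : 0 < r <= 1 ->
  exists n, normc g ^+ n.+1 <= r <= normc g ^+ n.
Proof.
move=> /andP[r0 r1]; have /andP[n0 n1] := conj_normc_bounds tp.
have [|m gm] := @expr_lt_eps R (normc g) r _ r0; first by lra.
have ex : exists n, normc g ^+ n <= r by exists m; exact: ltW.
case: (ex_minnP ex) => -[|n] nr min.
  by exists 0%N; rewrite expr0 r1 andbT (le_trans _ nr) // expr1 expr0; lra.
exists n; rewrite nr leNgt; apply/negP => /ltW /min; by rewrite ltnn.
Qed.

Lemma mass_small : exists2 C : R, 0 < C & forall s r p, 0 < s <= d -> 0 < r <= 1 ->
  exists n, forall l, (n <= l)%N -> mass l (fun x => normc (p - x) <= r) <= C * r `^ s.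
Proof.
have [K massK] := mass_disc tp FE cF F0 mu1 mu7.
have mu0 := lt_trans ltr01 mu1.
(* The summand 1 makes the constant positive; the factor [mu] pays for replacing [r] by the next
   larger power of [|g|]. *)
exists ((K%:R + 1) * mu); first by rewrite mulr_gt0 // ltr_wpDl.
move=> s r p /andP[s0 sd] r01; have /andP[r0 r1] := r01.
have [n /andP[nr rn]] := scale_exists r01; exists n => l nl.
apply: le_trans (mass_mono mu1 _ (fun x (h : normc (p - x) <= r) => le_trans h rn)) _.
apply: le_trans (massK l n p nl) _.
apply: (@le_trans _ _ ((K%:R + 1) * mu^-1 ^+ n)).
  by rewrite ler_wpM2r ?exprn_ge0 ?invr_ge0 ?(ltW mu0) // lerDl.
rewrite -mulrA ler_wpM2l ?addr_ge0 //.
apply: (@le_trans _ _ (mu * (normc g ^+ n.+1) `^ d)).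
  rewrite -[normc g ^+ n.+1]powR_mulrn ?normc_ge0 // -powRrM [_ * d]mulrC powRrM conj_powR_dim.
  by rewrite powR_mulrn ?invr_ge0 ?(ltW mu0) // exprS mulrA mulfV ?mul1r ?gt_eqF.
rewrite ler_wpM2l ?(ltW mu0) //; apply: (@le_trans _ _ (r `^ d)).
  apply: ge0_ler_powR; rewrite ?nnegrE ?exprn_ge0 ?normc_ge0 ?(ltW r0) //.
  exact: le_trans (ltW s0) sd.
by apply: ger_powR; rewrite // r0 r1.
Qed.

Local Open Scope ereal_scope.

Lemma diam_ge_dist (A : set (plane R)) (x y : R[i]%C) : A x -> A y ->
  (normc (x - y))%:E <= diam A.
Proof. by move=> Ax Ay; apply: ereal_sup_ubound; right; exists x => //; exists y. Qed.

Lemma hausdorff_measure_boundary (s : R) : (0 < s < d)%R ->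
  hausdorff_measure s (boundary F) != 0.
Proof.
move=> /andP[s0 sd]; apply/eqP => H0.
have [C C0 Cs] := mass_small.
(* The first term forces the radii used below to be at most 1; the second keeps the total mass at
   most 1/2, against the mass 1 of the core. *)
pose e : R := Num.min ((1 / 2) `^ s / 4)%R (1 / (4 * (C * 2 `^ s)))%R.
have p2 : (0 < 2 `^ s :> R)%R by rewrite powR_gt0.
have e0 : (0 < e)%R by rewrite lt_min !divr_gt0 ?mulr_gt0 ?powR_gt0.
have : hausdorff_premeasure s 1 (boundary F) < e%:E.
  apply: (@le_lt_trans _ _ 0); last by rewrite lte_fin.
  by rewrite -H0; apply: ereal_sup_ubound; exists 1%R => //=; exact: ltr01.
move=> /ereal_inf_lt [_ [U [UF Ud] <-] Ue].
pose dk k := fine (diam (U k)).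
have dkE k : diam (U k) = (dk k)%:E.
  by rewrite fineK // ge0_fin_numE ?diam_ge0 // (le_lt_trans (Ud k)) // ltry.
have dk0 k : (0 <= dk k)%R by rewrite -lee_fin -dkE diam_ge0.
(* A set of the cover may have diameter 0 and need not be open. The geometric term, of total at most
   [e], allows each to be thickened by a radius [rho k] larger than its diameter. *)
pose tau k : R := (dk k `^ s + geometric (e / 2) (1 / 2) k)%R.
have geo0 k : (0 < geometric (e / 2) (1 / 2) k)%R.
  by rewrite /geometric /= mulr_gt0 ?exprn_gt0 ?divr_gt0.
have tau0 k : (0 < tau k)%R by rewrite ltr_wpDl ?powR_ge0.
have tau_sum K : (\sum_(k < K) tau k <= 2 * e)%R.
  rewrite big_split /= mulr_natl mulr2n lerD //.
    rewrite -lee_fin -sumEFin; apply: le_trans (ltW Ue).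
    apply: (@le_trans _ _ (\sum_(0 <= k < K) diam (U k) `^ s)); last first.
      by apply: (nneseries_lim_ge K) => k _ _; exact: poweR_ge0.
    by rewrite big_mkord; apply: lee_sum => k _; rewrite dkE poweR_EFin.
  have -> : (\sum_(k < K) geometric (e / 2) (1 / 2) k = e - e * (1 / 2) ^+ K)%R.
    elim: K => [|K IHK]; first by rewrite big_ord0 expr0; lra.
    by rewrite big_ord_recr /= IHK /geometric /= exprS; field.
  by rewrite gerBl mulr_ge0 ?exprn_ge0 // ltW.
pose rho k : R := (tau k `^ s^-1)%R.
have rhos k : (rho k `^ s = tau k)%R.
  by rewrite /rho -powRrM mulVf ?gt_eqF // powRr1 // ltW.
have rho0 k : (0 < rho k)%R by rewrite powR_gt0.
have dkrho k : (dk k < rho k)%R.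
  rewrite ltNge; apply/negP => h; have := geo0 k; rewrite ltNge => /negP; apply.
  have : (rho k `^ s <= dk k `^ s)%R.
    by apply: ge0_ler_powR; rewrite ?nnegrE ?(ltW s0) ?(ltW (rho0 k)).
  by rewrite rhos /tau gerDl.
pose V k : set (plane R) := [set y | exists2 x, U k x & (normc (x - y : R[i]%C) < rho k)%R].
have Vo k : open (V k).
  apply/open_planeP => y [x Ux xy]; exists (rho k - normc (x - y : R[i]%C))%R.
    by rewrite subr_gt0.
  move=> z yz; exists x => //; rewrite (_ : x - z = (x - y) + (y - z))%R; last by ring.
  by apply: le_lt_trans (le_normcD _ _) _; rewrite addrC -ltrBrDr.
have VE x : core (F := F) x -> exists k, V k x.
  move=> [Fx Fx']; have /UF[k _ Ux] := overlap_boundary tp FE cF Fx Fx'.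
  by exists k, x; rewrite // subrr normc0.
have [K cK] := compact_finite_cover core_compact Vo VE.
have two_rho k : (k < K)%N -> (0 < 2 * rho k <= 1)%R.
  move=> kK; rewrite mulr_gt0 //=.
  have tk : (tau k <= (1 / 2) `^ s)%R.
    apply: (@le_trans _ _ (2 * e)%R).
      apply: le_trans (tau_sum K); rewrite (bigD1 (Ordinal kK)) //= lerDl sumr_ge0 //.
      by move=> i _; exact: ltW.
    have : (e <= (1 / 2) `^ s / 4)%R by rewrite ge_min lexx.
    by have := @powR_ge0 R (1 / 2) s; lra.
  have : (rho k <= 1 / 2)%R.
    rewrite leNgt; apply/negP => h; move: tk; rewrite -rhos leNgt => /negP; apply.
    by apply: gt0_ltr_powR; rewrite ?nnegrE ?(ltW (rho0 k)).
  by lra.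
have step k : exists n, forall l, (k < K)%N -> (n <= l)%N ->
    (mass l (V k) <= C * 2 `^ s * tau k)%R.
  have [kK|] := boolP (k < K)%N; last by exists 0%N.
  have [p pV] : exists p, forall y, V k y -> (normc (p - y) <= 2 * rho k)%R.
    have [[u Uu]|nU] := pselect (exists u, U k u); last first.
      by exists 0%R => y [x Ux]; exfalso; apply: nU; exists x.
    exists u => y [x Ux xy]; rewrite (_ : u - y = (u - x) + (x - y))%R; last by ring.
    apply: le_trans (le_normcD _ _) _.
    have ux : (normc (u - x : R[i]%C) <= dk k)%R by rewrite -lee_fin -dkE diam_ge_dist.
    have := dkrho k; lra.
  have sd' : (0 < s <= d)%R by rewrite s0 ltW.
  have [n hn] := Cs s _ p sd' (two_rho k kK).
  exists n => l _ nl; apply: le_trans (mass_mono mu1 l pV) _.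
  apply: le_trans (hn l nl) _.
  by rewrite powRM ?rhos ?mulrA // ltW.
have [n hn] := choice step.
(* The level in [mass_small] depends on the disc; the finite subcover permits a common one. *)
pose l := (\max_(k < K) n k)%N.
have := mass_cover tp FE cF F0 mu1 mu7 l cK.
apply/negP; rewrite -ltNge.
apply: (@le_lt_trans _ _ (\sum_(k < K) C * 2 `^ s * tau k)%R).
  apply: ler_sum => k _; apply: hn => //.
  exact: (@leq_bigmax _ (fun k : 'I_K => n k)).
rewrite -mulr_sumr.
have C2 : (0 < C * 2 `^ s)%R by rewrite mulr_gt0.
apply: (@le_lt_trans _ _ (C * 2 `^ s * (2 * e))%R); first by rewrite ler_pM2l.
have : (e <= 1 / (4 * (C * 2 `^ s)))%R by rewrite ge_min lexx orbT.
rewrite ler_pdivlMr ?mulr_gt0 //; lra.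
Qed.

Lemma hausdorff_dim_boundary_ge : d%:E <= hausdorff_dim (boundary F).
Proof.
apply: le_ereal_inf_tmp => _ [s [s0 sH] <-]; rewrite lee_fin leNgt; apply/negP => sd.
by have := hausdorff_measure_boundary (s := s); rewrite s0 sd sH eqxx => /(_ isT).
Qed.

End BoundaryLower.

(** * Numerical bounds *)

(* Powers in fixed-point arithmetic with unit [o]; every product is rounded down, then
   shifted by [rnd], which is 0 for a lower bound and 1 for an upper bound. *)
Local Open Scope Z_scope.

Fixpoint fx_pow (o rnd a : Z) (n : positive) : Z :=
  match n with
  | xH => a
  | xO n' => let h := fx_pow o rnd a n' in h * h / o + rnd
  | xI n' => let h := fx_pow o rnd a n' in a * (h * h / o + rnd) / o + rnd
  end.

Local Close Scope Z_scope.

Section Fractions.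
Context {R : realType}.

(** Denominators are cleared so that a rational bound becomes an integer comparison; [t^2 (t - 1)]
    is increasing for [t >= 1]. *)
Lemma cubic_ge_frac (x o z : R) : 0 < o -> 1 <= x -> x ^+ 3 = x ^+ 2 + 1 ->
  z * z * (z - o) <= o * o * o -> z / o <= x.
Proof.
move=> o0 x1 x3 h; rewrite ler_pdivrMr // leNgt; apply/negP => zx.
have zo : o <= x * o by rewrite ler_peMl // ltW.
have xo : 0 <= x * o by apply: le_trans zo; apply: ltW.
have x0 : 0 <= x by apply: le_trans x1.
have : x * o * (x * o) * (x * o - o) < z * z * (z - o).
  apply: ltr_pM; rewrite ?ltrD2r ?subr_ge0 //.
    exact: mulr_ge0.
  exact: ltr_pM.
apply/negP; rewrite -leNgt; apply: le_trans h _.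
rewrite le_eqVlt; apply/orP; left; apply/eqP.
rewrite [RHS](_ : _ = (x ^+ 3 - x ^+ 2) * (o * o * o)); last by ring.
by rewrite x3; ring.
Qed.

Lemma cubic_le_frac (x o z : R) : 0 < o -> 1 <= x -> x ^+ 3 = x ^+ 2 + 1 ->
  o <= z -> o * o * o <= z * z * (z - o) -> x <= z / o.
Proof.
move=> o0 x1 x3 oz h; rewrite ler_pdivlMr // leNgt; apply/negP => zx.
have z0 : 0 <= z by apply: le_trans oz; apply: ltW.
have : z * z * (z - o) < x * o * (x * o) * (x * o - o).
  apply: ltr_pM; rewrite ?ltrD2r ?subr_ge0 //.
    exact: mulr_ge0.
  exact: ltr_pM.
apply/negP; rewrite -leNgt; apply: le_trans h.
rewrite le_eqVlt; apply/orP; left; apply/eqP.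
rewrite [LHS](_ : _ = (x ^+ 3 - x ^+ 2) * (o * o * o)); last by ring.
by rewrite x3; ring.
Qed.

(** The polynomial is [t^2 (t^5 - 2)], a product of nonnegative increasing factors once
    [t^5 >= 2]. *)
Lemma septic_mono (x y : R) : 0 <= x < y -> 2 <= x ^+ 5 ->
  x ^+ 7 - 2 * x ^+ 2 < y ^+ 7 - 2 * y ^+ 2.
Proof.
move=> /andP[x0 xy] x5.
have e (z : R) : z ^+ 7 - 2 * z ^+ 2 = z ^+ 2 * (z ^+ 5 - 2) by ring.
rewrite !e ltr_pM ?sqr_ge0 ?subr_ge0 //.
  by rewrite ltrXn2r.
by rewrite ltrD2r ltrXn2r.
Qed.

Lemma septic_frac (o z : R) : 0 < o ->
  z ^+ 2 * (z ^+ 5 - 2 * o ^+ 5) = o ^+ 7 * ((z / o) ^+ 7 - 2 * (z / o) ^+ 2).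
Proof. by move=> o0; field; rewrite gt_eqF. Qed.

Lemma septic_ge_frac (x o z : R) : 0 < o -> 1 <= x -> x ^+ 7 = 2 * x ^+ 2 + 1 ->
  z ^+ 2 * (z ^+ 5 - 2 * o ^+ 5) <= o ^+ 7 -> z / o <= x.
Proof.
move=> o0 x1 x7 h; rewrite leNgt; apply/negP => xa.
have x5 : 2 <= x ^+ 5.
  have : 0 < x ^+ 2 * (x ^+ 5 - 2).
    by rewrite (_ : _ * _ = x ^+ 7 - 2 * x ^+ 2); [rewrite x7; lra | ring].
  rewrite pmulr_rgt0 ?subr_gt0; first exact: ltW.
  by rewrite exprn_gt0 // (lt_le_trans ltr01).
have xz : 0 <= x < z / o by rewrite xa (le_trans ler01 x1).
have := septic_mono xz x5.
rewrite x7 (_ : _ - _ = 1); last by ring.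
by move: h; rewrite septic_frac // ger_pMr ?exprn_gt0 // leNgt => /negbTE ->.
Qed.

Lemma septic_le_frac (x o z : R) : 0 < o -> x ^+ 7 = 2 * x ^+ 2 + 1 -> 0 <= z ->
  2 * o ^+ 5 <= z ^+ 5 -> o ^+ 7 <= z ^+ 2 * (z ^+ 5 - 2 * o ^+ 5) -> x <= z / o.
Proof.
move=> o0 x7 z0 z5 h; rewrite leNgt; apply/negP => xa.
have fx5 : 2 <= (z / o) ^+ 5 by rewrite expr_div_n ler_pdivlMr ?exprn_gt0.
have zx : 0 <= z / o < x by rewrite xa divr_ge0 // ltW.
have := septic_mono zx fx5.
rewrite x7 (_ : 2 * _ + _ - _ = 1); last by ring.
by move: h; rewrite septic_frac // ler_pMr ?exprn_gt0 // leNgt => /negbTE ->.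
Qed.

End Fractions.

Section FixedPoint.
Context {R : realType} {o : Z}.
Hypothesis o0 : Z.ltb Z0 o.


Definition fx (a : Z) : R := zr a / zr o.

Lemma zr0 : zr Z0 = 0 :> R. Proof. by []. Qed.

Lemma zr_gt0 a : Z.ltb Z0 a -> 0 < zr a :> R.
Proof. by move=> /(@zr_lt R); rewrite zr0. Qed.

Lemma unit_gt0 : 0 < zr o :> R.
Proof. exact: zr_gt0. Qed.

Lemma fx_le a b : Z.leb a b -> fx a <= fx b.
Proof. by move=> /(@zr_le R) ab; rewrite ler_pM2r // invr_gt0 unit_gt0. Qed.

Lemma fx_ge0 a : Z.leb Z0 a -> 0 <= fx a.
Proof. by move=> /fx_le; rewrite {1}/fx zr0 mul0r. Qed.

Lemma fx_ge1 a : Z.leb o a -> 1 <= fx a.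
Proof. by move=> /(@zr_le R) oa; rewrite ler_pdivlMr ?unit_gt0 // mul1r. Qed.

Lemma zr_div (a b : Z) : Z.ltb Z0 b ->
  @zr R (Z.div a b) <= @zr R a / @zr R b < @zr R (Z.div a b) + 1.
Proof.
move=> b0; have zb := @zr_gt0 b b0.
rewrite ler_pdivlMr // ltr_pdivrMr // -[1]/(@zr R (Zpos 1)) -zrD -!zrM.
have := Z.div_mod a b; have := Z.mod_pos_bound a b.
move=> h1 h2; apply/andP; split; [apply: zr_le | apply: zr_lt]; nia.
Qed.

Lemma fx_mul_down (a b : Z) : fx (Z.div (Z.mul a b) o) <= fx a * fx b.
Proof.
have zo := unit_gt0; have /andP[h _] := @zr_div (Z.mul a b) o o0.
by rewrite /fx mulrACA -zrM mulrA ler_pM2r // ?invr_gt0.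
Qed.

Lemma fx_mul_up (a b : Z) : fx a * fx b <= fx (Z.add (Z.div (Z.mul a b) o) (Zpos 1)).
Proof.
have zo := unit_gt0; have /andP[_ h] := @zr_div (Z.mul a b) o o0.
by rewrite /fx mulrACA -zrM mulrA ler_pM2r ?invr_gt0 // zrD ltW.
Qed.

Lemma fx_pow_up (x : R) a n : 0 <= x <= fx a ->
  x ^+ Pos.to_nat n <= fx (fx_pow o (Zpos 1) a n).
Proof.
move=> /andP[x0 xa].
have half (h : Z) k : x ^+ k <= fx h ->
    x ^+ (k + k) <= fx (Z.add (Z.div (Z.mul h h) o) (Zpos 1)).
  move=> xh; apply: le_trans (fx_mul_up h h).
  by rewrite exprD ler_pM ?exprn_ge0.
elim: n => [n /half IHn|n /half IHn|]; last by rewrite expr1.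
- rewrite (_ : Pos.to_nat _ = (Pos.to_nat n + Pos.to_nat n).+1); last by lia.
  apply: le_trans (fx_mul_up _ _).
  by rewrite exprS ler_pM ?exprn_ge0.
- by rewrite (_ : Pos.to_nat _ = Pos.to_nat n + Pos.to_nat n)%N; last by lia.
Qed.

Lemma fx_pow_down (x : R) a n : Z.leb Z0 a -> fx a <= x ->
  fx (fx_pow o Z0 a n) <= x ^+ Pos.to_nat n.
Proof.
move=> a0 ax.
suff: Z.leb Z0 (fx_pow o Z0 a n) && (fx (fx_pow o Z0 a n) <= x ^+ Pos.to_nat n).
  by case/andP.
have quot (p q : Z) : Z.leb Z0 p -> Z.leb Z0 q ->
    Z.leb Z0 (Z.add (Z.div (Z.mul p q) o) Z0).
  move=> p0 q0; rewrite Z.add_0_r; apply/Z.leb_le; apply: Z.div_pos; last exact/Z.ltb_lt.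
  by apply: Z.mul_nonneg_nonneg; apply/Z.leb_le.
have half (h : Z) k : Z.leb Z0 h && (fx h <= x ^+ k) ->
    Z.leb Z0 (Z.add (Z.div (Z.mul h h) o) Z0) &&
    (fx (Z.add (Z.div (Z.mul h h) o) Z0) <= x ^+ (k + k)).
  move=> /andP[h0 hx]; rewrite quot //= Z.add_0_r; apply: le_trans (fx_mul_down h h) _.
  by rewrite exprD ler_pM ?fx_ge0.
elim: n => [n /half/andP[h0 hx]|n /half IHn|]; last by rewrite expr1 a0.
- rewrite (_ : Pos.to_nat _ = (Pos.to_nat n + Pos.to_nat n).+1); last by lia.
  rewrite [fx_pow _ _ _ _]/= quot //= Z.add_0_r; apply: le_trans (fx_mul_down _ _) _.
  by rewrite exprS ler_pM ?fx_ge0.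
- by rewrite (_ : Pos.to_nat _ = Pos.to_nat n + Pos.to_nat n)%N; last by lia.
Qed.

End FixedPoint.

Lemma zr_natE {R : realType} (p : positive) (n : nat) :
  Z.of_nat n = Zpos p -> n%:R = zr (Zpos p) :> R.
Proof.
move=> e; rewrite /zr /= (_ : Pos.to_nat p = n) //; lia.
Qed.

Local Open Scope Z_scope.
Definition unit12 : Z := 1000000000000.
Definition al_lo : Z := 1465571231876.
Definition al_hi : Z := 1465571231877.
Definition mu_lo : Z := 1217458216550.
Definition mu_hi : Z := 1217458216551.
(* Bounds for mu^2 / alpha. *)
Definition ratio_lo : Z := 1011349347480.
Definition ratio_hi : Z := 1011349347483.
Definition zpow5 (a : Z) : Z := a * a * a * a * a.
Definition zpow7 (a : Z) : Z := a * a * zpow5 a.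
Definition zseptic (a b : Z) : Z := a * a * (zpow5 a - 2 * zpow5 b).
Local Close Scope Z_scope.

Lemma zr_pow5 {R : realType} (a : Z) : zr (zpow5 a) = zr a ^+ 5 :> R.
Proof. by rewrite !zrM; ring. Qed.

Lemma zr_pow7 {R : realType} (a : Z) : zr (zpow7 a) = zr a ^+ 7 :> R.
Proof. by rewrite 2!zrM zr_pow5; ring. Qed.

Lemma zr_septic {R : realType} (a b : Z) :
  zr (zseptic a b) = zr a ^+ 2 * (zr a ^+ 5 - 2 * zr b ^+ 5) :> R.
Proof. by rewrite 2!zrM zrB [zr (Z.mul (Zpos 2) _)]zrM !zr_pow5 !zrE; ring. Qed.

Lemma alpha_fx {R : realType} (x : R) : 1 <= x -> x ^+ 3 = x ^+ 2 + 1 ->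
  @fx R unit12 al_lo <= x <= @fx R unit12 al_hi.
Proof.
move=> x1 x3.
have o0 : 0 < @zr R unit12 by apply: zr_gt0.
have h1 : Z.leb (al_lo * al_lo * (al_lo - unit12)) (unit12 * unit12 * unit12) by [].
have h2 : Z.leb (unit12 * unit12 * unit12) (al_hi * al_hi * (al_hi - unit12)) by [].
have h3 : Z.leb unit12 al_hi by [].
rewrite /fx; move: unit12 al_lo al_hi o0 h1 h2 h3 => o a b o0.
move=> /(@zr_le R) h1 /(@zr_le R) h2 /(@zr_le R) h3.
rewrite !zrM zrB in h1; rewrite !zrM zrB in h2.
by rewrite cubic_ge_frac // cubic_le_frac.
Qed.

Lemma mu_fx {R : realType} (x : R) : 1 <= x -> x ^+ 7 = 2 * x ^+ 2 + 1 ->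
  @fx R unit12 mu_lo <= x <= @fx R unit12 mu_hi.
Proof.
move=> x1 x7.
have o0 : 0 < @zr R unit12 by apply: zr_gt0.
have h1 : Z.leb (zseptic mu_lo unit12) (zpow7 unit12) by vm_compute.
have h2 : Z.leb (zpow7 unit12) (zseptic mu_hi unit12) by vm_compute.
have h3 : Z.leb (Z.mul (Zpos 2) (zpow5 unit12)) (zpow5 mu_hi) by vm_compute.
have h4 : Z.leb Z0 mu_hi by [].
rewrite /fx; move: unit12 mu_lo mu_hi o0 h1 h2 h3 h4 => o a b o0.
move=> /(@zr_le R) h1 /(@zr_le R) h2 /(@zr_le R) h3 /(@zr_le R) h4.
rewrite zr_pow7 zr_septic in h1; rewrite zr_pow7 zr_septic in h2.
rewrite zrM !zr_pow5 !zrE mulr1 in h3; rewrite zrE in h4.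
by rewrite septic_ge_frac // septic_le_frac.
Qed.

(** The logarithm of [mu^2 / alpha] over that of [alpha] is the dimension minus 1. This quotient is
    close to 1, so even its large powers stay moderate in fixed-point arithmetic. *)
Lemma mu_alpha_fx {R : realType} (x y : R) : 1 <= x -> x ^+ 3 = x ^+ 2 + 1 ->
  1 <= y -> y ^+ 7 = 2 * y ^+ 2 + 1 ->
  @fx R unit12 ratio_lo <= y ^+ 2 / x <= @fx R unit12 ratio_hi.
Proof.
move=> x1 x3 y1 y7.
have := alpha_fx x1 x3; have := mu_fx y1 y7.
have o0 : 0 < @zr R unit12 by apply: zr_gt0.
have h1 : Z.leb (ratio_lo * al_hi) (mu_lo * mu_lo) by [].
have h2 : Z.leb (mu_hi * mu_hi) (ratio_hi * al_lo) by [].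
have h3 : Z.leb Z0 mu_lo by [].
have h4 : Z.leb Z0 ratio_lo by [].
have h5 : Z.leb Z0 ratio_hi by [].
rewrite /fx; move: unit12 mu_lo mu_hi al_lo al_hi ratio_lo ratio_hi o0 h1 h2 h3 h4 h5.
move=> o a b c d u v o0 /(@zr_le R) h1 /(@zr_le R) h2 /(@zr_le R) h3 /(@zr_le R) h4 /(@zr_le R) h5.
rewrite !zrM in h1; rewrite !zrM in h2; rewrite zrE in h3; rewrite zrE in h4; rewrite zrE in h5.
move=> /andP[ay yb] /andP[cx xd].
have x0 : 0 < x by apply: lt_le_trans x1.
have y0 : 0 <= y by apply: le_trans y1.
have oV : 0 <= (zr o)^-1 :> R by rewrite invr_ge0 ltW.
have oV2 : 0 <= (zr o)^-1 * (zr o)^-1 :> R by rewrite mulr_ge0.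
rewrite ler_pdivlMr // ler_pdivrMr //; apply/andP; split.
  apply: le_trans (_ : zr u / zr o * (zr d / zr o) <= _).
    by rewrite ler_wpM2l // mulr_ge0.
  apply: le_trans (_ : zr a / zr o * (zr a / zr o) <= _).
    by rewrite !(mulrACA _ (zr o)^-1) ler_wpM2r.
  by rewrite expr2 ler_pM // mulr_ge0.
apply: le_trans (_ : zr b / zr o * (zr b / zr o) <= _).
  by rewrite expr2 ler_pM.
apply: le_trans (_ : zr v / zr o * (zr c / zr o) <= _).
  by rewrite !(mulrACA _ (zr o)^-1) ler_wpM2r.
by rewrite ler_wpM2l // mulr_ge0.
Qed.

(** The inequality between logarithms amounts to [x^m <= y^n], which follows from an upper bound for
    the left side and a lower bound for the right. *)
Lemma ln_ratio {R : realType} (x y : R) (s t : Z) (m n : positive) :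
  1 <= x -> 1 <= y -> x <= @fx R unit12 s -> @fx R unit12 t <= y -> Z.leb Z0 t ->
  Z.leb (fx_pow unit12 (Zpos 1) s m) (fx_pow unit12 Z0 t n) ->
  zr (Zpos m) * ln x <= zr (Zpos n) * ln y.
Proof.
move=> x1 y1 xs ty t0 st.
have zn (p : positive) : zr (Zpos p) = (Pos.to_nat p)%:R :> R by [].
rewrite !zn !mulr_natl -!lnXn ?(lt_le_trans ltr01) //.
rewrite ler_ln ?posrE ?exprn_gt0 ?(lt_le_trans ltr01) //.
have x0 : 0 <= x <= @fx R unit12 s by rewrite xs (le_trans ler01 x1).
apply: le_trans (fx_pow_up _ _ x0) _ => //.
apply: le_trans (fx_pow_down _ _ t0 ty) => //.
exact: fx_le.
Qed.

Lemma alpha_approx {R : realType} (x : R) : 1 <= x -> x ^+ 3 = x ^+ 2 + 1 ->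
  `|x - 146557%:R / 10 ^+ 5| <= 5 / 10 ^+ 6.
Proof.
move=> x1 x3; rewrite [X in _ - X / _](@zr_natE _ 146557) // ler_norml.
have /andP[] := alpha_fx x1 x3.
rewrite /fx ler_pdivrMr ?zr_gt0 // ler_pdivlMr ?zr_gt0 // !zrE => h1 h2.
by apply/andP; split; lra.
Qed.

Lemma mu_approx {R : realType} (x : R) : 1 <= x -> x ^+ 7 = 2 * x ^+ 2 + 1 ->
  `|x - 121746%:R / 10 ^+ 5| <= 5 / 10 ^+ 6.
Proof.
move=> x1 x3; rewrite [X in _ - X / _](@zr_natE _ 121746) // ler_norml.
have /andP[] := mu_fx x1 x3.
rewrite /fx ler_pdivrMr ?zr_gt0 // ler_pdivlMr ?zr_gt0 // !zrE => h1 h2.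
by apply/andP; split; lra.
Qed.

(* The integer comparisons 8 ln alpha <= 271 ln (mu^2 / alpha) and
   1829 ln (mu^2 / alpha) <= 54 ln alpha come from continued fraction convergents of
   2 ln mu / ln alpha - 1. *)
Lemma dimension_approx {R : realType} (x y : R) : 1 < x -> x ^+ 3 = x ^+ 2 + 1 ->
  1 <= y -> y ^+ 7 = 2 * y ^+ 2 + 1 ->
  `|2 * ln y / ln x - 102952%:R / 10 ^+ 5| <= 5 / 10 ^+ 6.
Proof.
move=> x1 x3 y1 y7; rewrite [X in _ - X / _](@zr_natE _ 102952) // ler_norml.
have L0 : 0 < ln x by rewrite ln_gt0.
have /andP[a1 a2] := alpha_fx (ltW x1) x3.
have /andP[r1 r2] := mu_alpha_fx (ltW x1) x3 y1 y7.
have r : 1 <= y ^+ 2 / x.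
  by apply: le_trans r1; apply: fx_ge1.
have lr : ln (y ^+ 2 / x) = 2 * ln y - ln x.
  have y0 : 0 < y by apply: lt_le_trans y1.
  have x0 : 0 < x by apply: lt_trans x1.
  by rewrite ln_div ?posrE ?exprn_gt0 // lnXn // mulr_natl.
have := @ln_ratio R _ _ ratio_hi al_lo 1829 54 r (ltW x1) r2 a1 isT.
have := @ln_ratio R _ _ al_hi ratio_lo 8 271 (ltW x1) r a2 r1 isT.
move=> /(_ ltac:(by vm_compute)) h1 /(_ ltac:(by vm_compute)) h2.
rewrite lr !zrE in h1 h2; rewrite !zrE => {a1 a2 r1 r2 r lr}.
apply/andP; split.
  rewrite lerBrDr ler_pdivlMr //; lra.
rewrite lerBlDr ler_pdivrMr //; lra.
Qed.

(** * The theorem *)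

(** A real root in [1, 2] exists by intermediate values, so dominance gives [|mu| >= 1]; a negative
    [mu] would make [mu^7] negative, and 1 is not a root. *)
Lemma septic_dominant_root (R : realType) (mu : R) :
  dominant_root ('X^7 - 2%:P * 'X^2 - 1 : {poly R[i]%C}) mu%:C%C ->
  1 < mu /\ mu ^+ 7 = 2 * mu ^+ 2 + 1.
Proof.
have rootE (t : R) :
    root ('X^7 - 2%:P * 'X^2 - 1 : {poly R[i]%C}) t%:C%C = (t ^+ 7 == 2 * t ^+ 2 + 1).
  rewrite /root !(hornerXn, hornerD, hornerN, hornerM, hornerC).
  rewrite (_ : _ - _ = (t ^+ 7 - (2 * t ^+ 2 + 1))%:C%C).
    by rewrite -[RHS]subr_eq0 -[RHS](inj_eq (@complexI R)).
  have -> : (2 : R[i]%C) = (2 : R)%:C%C by rewrite [RHS](rmorph_nat _ 2).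
  rewrite [RHS]rmorphB [X in _ = _ - X]rmorphD [X in _ = _ - (X + _)]rmorphM /=.
  rewrite [X in _ = X - _](rmorphXn _ 7) [X in _ = _ - (_ * X + _)](rmorphXn _ 2).
  by rewrite [X in _ = _ - (_ + X)]rmorph1 opprD addrA.
rewrite /dominant_root rootE => -[/eqP mu7 mu_max].
have [||t /andP[t1 _] tr] := @poly_ivt R ('X^7 - 2%:P * 'X^2 - 1) 1 2; first by lra.
  by rewrite !(hornerXn, hornerD, hornerN, hornerM, hornerC); lra.
have t7 : t ^+ 7 = 2 * t ^+ 2 + 1.
  by move: tr; rewrite /root !(hornerXn, hornerD, hornerN, hornerM, hornerC) -addrA -opprD subr_eq0 => /eqP.
have := mu_max t%:C%C; rewrite rootE t7 eqxx => /(_ isT).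
rewrite !normc_def /= !expr0n /= !addr0 lecR !sqrtr_sqr (ger0_norm (le_trans ler01 t1)) => tm.
have mu0 : 0 <= mu.
  rewrite leNgt; apply/negP => mun; have := sqr_ge0 (mu ^+ 3); have := sqr_ge0 mu.
  have : mu ^+ 7 = mu * (mu ^+ 3) ^+ 2 by ring.
  by rewrite mu7; nra.
rewrite (ger0_norm mu0) in tm.
split=> //; rewrite lt_neqAle (le_trans t1 tm) andbT; apply/eqP => m1.
by move: mu7; rewrite -m1 !expr1n; lra.
Qed.

(** The cubic equation is pulled back to [K] along the injective [iota] and then carried to the
    plane by [psi]. From [a^2 (a - 1) = 1] the quotient [a / (a - 1)] is [a^3]. *)
Lemma embedding_tent_pair (R : realType) (K : fieldExtType rat) (a : K)
    (iota : {rmorphism K -> R}) (psi : {rmorphism K -> R[i]%C}) :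
  root ('X^3 - 'X^2 - 1 : {poly R}) (iota a) -> psi a \isn't Num.real ->
  tent_pair (iota a) (psi a) /\ a / (a - 1) = a ^+ 3.
Proof.
move=> ra nr.
have a3 : a ^+ 3 = a ^+ 2 + 1.
  apply: (fmorph_inj iota); apply/eqP.
  rewrite rmorphD !rmorphXn rmorph1 -subr_eq0 opprD addrA.
  by move: ra; rewrite /root !hornerE.
split; first split.
- by rewrite -rmorphXn a3 rmorphD rmorphXn rmorph1.
- by rewrite -rmorphXn a3 rmorphD rmorphXn rmorph1.
- by move: nr; case: (psi a) => x y; rewrite complex_real.
have a21 : a ^+ 2 * (a - 1) = 1 by rewrite mulrBr mulr1 -exprSr a3; ring.
have a1 : a - 1 != 0.
  by apply/eqP => a0; move: a21; rewrite a0 mulr0 => /esym/eqP; rewrite oner_eq0.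
by apply: (mulIf a1); rewrite divfK // exprS -mulrA a21 mulr1.
Qed.

Section TentTileEmbedding.
Context {R : realType} {K : fieldExtType rat} {psi : {rmorphism K -> R[i]%C}} {a : K}.
Let g := psi a.
Hypothesis aV : a / (a - 1) = a ^+ 3.

Lemma tent_tile_set (F : set (plane R)) : is_tent_tile psi a F -> tent_set g F.
Proof.
move=> [_ _ FE] x; rewrite [in X in X <-> _]FE; split.
- move=> [[y Fy <-]|[y Fy <-]]; [left|right]; exists y => //.
  by rewrite /tent_right aV rmorph1 rmorphXn.
- move=> [[y Fy ->]|[y Fy ->]]; [left|right]; exists y => //.
  by rewrite /tent_right aV rmorph1 rmorphXn.
Qed.

Definition tent_index (i : bool * (int * int)) : plane R * bool :=
  (i.2.1%:~R * psi (1 - a) + i.2.2%:~R * psi (1 - a ^+ 2), i.1).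

Lemma tent_translateE (F : set (plane R)) i :
  tent_translate psi F (tent_index i) = in_tile_at g F i.
Proof.
case: i => e [u v]; rewrite /tent_translate /in_tile_at /in_tile /shift /=.
rewrite !rmorphB rmorph1 rmorphXn -/g.
apply/seteqP; split=> x /=.
  case: e => -[y]; first move=> [y' Fy' <-] <-; last move=> Fy <-.
    by exists y' => //; rewrite /=; ring.
  by exists y => //; rewrite /=; ring.
case: e => -[y Fy ->].
  by exists (1 - y); [exists y | rewrite /=; ring].
by exists y => //; rewrite /=; ring.
Qed.

Lemma tent_index_lattice x : (tent_lattice psi a `*` [set: bool]) x <-> exists i, x = tent_index i.
Proof.
case: x => z e; split=> [[/= [u [v ->]] _]|[i ->]].
  by exists (e, (u, v)).
by split=> //; exists i.2.1, i.2.2.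
Qed.

Lemma tent_proper_tiling al (F : set (plane R)) :
  tent_pair al g -> is_tent_tile psi a F ->
  proper_tiling (tent_lattice psi a `*` [set: bool]) (tent_translate psi F).
Proof.
move=> tp tF; have FE := tent_tile_set tF; have [F0 cF _] := tF.
split.
- move=> x /tent_index_lattice[[e [u v]] ->]; rewrite tent_translateE.
  rewrite (_ : in_tile_at _ _ _ =
    (fun x : plane R => shift g e u v + (-1) ^+ e * x : plane R) @` F); last first.
    by apply/seteqP; split=> y /= [z Fz yE]; exists z.
  by apply: continuous_compact => //; apply: continuous_subspaceT; exact: continuous_affine.
- apply/seteqP; split=> // p _; have [e [u [v pi]]] := tiles_cover tp FE cF p F0.
  exists (tent_index (e, (u, v))); first by apply/tent_index_lattice; exists (e, (u, v)).
  by rewrite tent_translateE.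
- move=> B cB; have [M BM] := compact_plane_bounded cB.
  have [D nearD] := tile_near tp FE cF M.
  apply: (@sub_finite_set _ _ (tent_index @` [set` box D])); last first.
    by apply: finite_image; exact: finite_seq.
  move=> x [/tent_index_lattice[[e [u v]] ->]]; rewrite tent_translateE => -[p [Bp pi]].
  by exists (e, (u, v)) => //=; apply: nearD pi (BM _ Bp).
have := tiles_ae tp FE cF.
apply: (@negligibleS _ _ R) => p /= np h; apply: np.
have [e [u [v pi]]] := tiles_cover tp FE cF (p.1 +i* p.2)%C F0.
exists (tent_index (e, (u, v))); split.
  by split; [apply/tent_index_lattice; exists (e, (u, v)) | rewrite tent_translateE].
move=> x [/tent_index_lattice[j ->]]; rewrite tent_translateE => pj.
by rewrite (h (e, (u, v)) j).
Qed.

End TentTileEmbedding.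

Theorem theorem5p3 (R : realType)
  (* alpha is the real root of t^3 - t^2 - 1 *)
  (alpha : R) (Halpha : root ('X^3 - 'X^2 - 1 : {poly R}) alpha)
  (* K is the number field Q(alpha), identified with a subfield of R by iota *)
  (K : fieldExtType rat) (a : K) (Ka : <<1; a>>%VS = {:K}%VS)
  (iota : {rmorphism K -> R}) (Hiota : iota a = alpha)
  (* alpha' is a non-real Galois conjugate of alpha and psi its embedding *)
  (alpha' : R[i]%C) (Hconj : galois_conjugate alpha alpha')
  (Hnonreal : alpha' \isn't Num.real)
  (psi : {rmorphism K -> R[i]%C}) (Hpsi : psi a = alpha')
  (* F is the tent-tile *)
  (F : set (plane R)) (HF : is_tent_tile psi a F)
  (* mu is the dominant root of t^7 - 2 t^2 - 1 *)
  (mu : R)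
  (Hmu : dominant_root ('X^7 - 2%:P * 'X^2 - 1 : {poly R[i]%C}) mu%:C%C) :
  [/\ hausdorff_dim (boundary F) = (2 * ln mu / ln alpha)%:E,
      [/\ `|alpha - 146557%:R / 10 ^+ 5| <= 5 / 10 ^+ 6,
          `|mu - 121746%:R / 10 ^+ 5| <= 5 / 10 ^+ 6 &
          `|2 * ln mu / ln alpha - 102952%:R / 10 ^+ 5| <= 5 / 10 ^+ 6] &
      proper_tiling (tent_lattice psi a `*` [set: bool])
                    (tent_translate psi F)].
Proof.
subst alpha alpha'.
have [tp aV] := embedding_tent_pair Halpha Hnonreal.
have FE := tent_tile_set aV HF; have [F0 cF _] := HF.
have [mu1 mu7] := septic_dominant_root Hmu.
have [al3 _ _] := tp; have al1 := alpha_gt1 tp.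
split; last exact: tent_proper_tiling tp HF.
- have le := hausdorff_dim_boundary_le tp FE cF F0 mu1 mu7.
  have ge := hausdorff_dim_boundary_ge tp FE cF F0 mu1 mu7.
  by apply/eqP; rewrite eq_le le.
split.
- exact: alpha_approx (ltW al1) al3.
- exact: mu_approx (ltW mu1) mu7.
- exact: dimension_approx al1 al3 (ltW mu1) mu7.
Qed.
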